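(* Let $\Gamma$ be a primitive strongly regular graph with standard parameters $(v,k,\lambda,\mu)$ (not a conference graph) and with smallest eigenvalue $-m$, where $m$ is a positive integer. Let $f(m,\mu) = \frac{8}{3} m(\mu-1) - \frac{2}{3}\mu + 3m - \frac{10}{3}$. Then the following hold: (i) If $\mu = m(m-1)$ and $\lambda > f(m,\mu)$, then $\Gamma$ is the collinearity graph of a partial geometry $\mathrm{pg}(s,t,\alpha)$ with $\alpha = t$; that is, a Latin square graph $\mathrm{LS}_m(\lambda - m(m-3))$. (ii) If $\mu = m^2$ and $\lambda > f(m,\mu)$, then $\Gamma$ is the collinearity graph of a partial geometry $\mathrm{pg}(s,t,\alpha)$ with $\alpha = t+1$; that is, the block graph of a $2$-$(\lambda(m-1) - m(m-1)(m-2) + m,\, m,\, 1)$ design. (iii) If $\mu \neq m(m-1)$ and $\mu \neq m^2$, then $\lambda \leq f(m,\mu)$.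
   Context: All graphs are finite, simple, connected and not complete. A strongly regular graph with standard parameters $(v,k,\lambda,\mu)$ is a $k$-regular graph on $v$ vertices of diameter $2$ in which every two adjacent vertices have exactly $\lambda$ common neighbours and every two distinct non-adjacent vertices have exactly $\mu$ common neighbours. It is primitive if both it and its complement are connected. A conference graph is a strongly regular graph with parameters $(4r+1,2r,r-1,r)$; throughout, strongly regular graphs are assumed not to be conference graphs. Eigenvalues of a graph are those of its adjacency matrix. An incidence structure is a triple $(\mathcal P,\mathcal L,\mathcal I)$ with $\mathcal P$ (points), $\mathcal L$ (lines) non-empty disjoint sets and $\mathcal I\subseteq\mathcal P\times\mathcal L$. A partial linear space is an incidence structure in which any two distinct points are both incident with at most one line. Its point graph (collinearity graph) has vertex set $\mathcal P$, two distinct points being adjacent iff they lie on a common line. A partial geometry $\mathrm{pg}(s,t,\alpha)$, with $s,t,\alpha>0$, is a partial linear space in which every line contains exactly $s+1$ points, every point lies on exactly $t+1$ lines, and for every line $\ell$ and point $x\notin\ell$ there are exactly $\alpha$ lines containing $x$ and meeting $\ell$. An orthogonal array $\mathrm{OA}(m,n)$ is an $m\times n^2$ array with entries from an $n$-element set such that, for any two rows, the $n^2$ ordered pairs formed by them are all distinct. A Latin square graph $\mathrm{LS}_m(n)$ is a graph whose vertices are the $n^2$ columns of some $\mathrm{OA}(m,n)$, two (distinct) columns being adjacent iff they agree in one coordinate position. The block graph of a $2$-$(V,m,1)$ design has the blocks as vertices, two distinct blocks being adjacent iff they intersect. *)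

(* Defs.v *)
From mathcomp Require Import all_boot all_order all_algebra all_field.
Set Implicit Arguments.
Unset Strict Implicit.
Unset Printing Implicit Defensive.
Import Order.TTheory GRing.Theory Num.Theory.

Record sgraph := SGraph {
  vertex :> finType;
  adj : rel vertex;
  adj_sym : symmetric adj;
  adj_irrefl : irreflexive adj
}.
Arguments SGraph {vertex} adj adj_sym adj_irrefl.

Definition isomorphic (G H : sgraph) : Prop :=
  exists f : G -> H, bijective f /\ forall x y, adj (f x) (f y) = adj x y.

Definition connected (G : sgraph) : Prop := forall x y : G, connect (@adj G) x y.

Section Complement.
Variable G : sgraph.
Definition compl_adj : rel G := fun x y => (x != y) && ~~ adj x y.
Lemma compl_sym : symmetric compl_adj.
Proof. by move=> x y; rewrite /compl_adj eq_sym adj_sym. Qed.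
Lemma compl_irrefl : irreflexive compl_adj.
Proof. by move=> x; rewrite /compl_adj eqxx. Qed.
Definition complement : sgraph := SGraph compl_adj compl_sym compl_irrefl.
End Complement.

(* Since [path] lists a walk without its first vertex, [size p] is its length.
   The second conjunct makes G nonempty. *)
Definition has_diameter (G : sgraph) (d : nat) : Prop :=
  (forall x y : G,
     exists p : seq G, [/\ path (@adj G) x p, last x p = y & size p <= d]) /\
  (exists x y : G,
     forall p : seq G, path (@adj G) x p -> last x p = y -> d <= size p).

Definition common_neighbours (G : sgraph) (x y : G) : {set G} :=
  [set z | adj x z & adj y z].

(* Diameter 2 already forces G to be connected and not complete. *)
Definition strongly_regular (G : sgraph) (v k lambda mu : nat) : Prop :=
  [/\ #|G| = v,
      forall x : G, #|[set y | adj x y]| = k,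
      has_diameter G 2,
      forall x y : G, adj x y -> #|common_neighbours x y| = lambda
    & forall x y : G, x != y -> ~~ adj x y -> #|common_neighbours x y| = mu].

Definition primitive (G : sgraph) : Prop :=
  connected G /\ connected (complement G).

Definition conference (G : sgraph) : Prop :=
  exists2 r : nat, 0 < r & strongly_regular G (4 * r + 1) (2 * r) (r - 1) r.

Definition adjmx (G : sgraph) : 'M[algC]_#|G| :=
  (\matrix_(i, j) (adj (enum_val i) (enum_val j))%:R)%R.

Definition smallest_eigenvalue (G : sgraph) (a : algC) : Prop :=
  eigenvalue (adjmx G) a /\ forall b, eigenvalue (adjmx G) b -> (a <= b)%R.

Record incidence_structure := IncidenceStructure {
  point : finType;
  line : finType;
  inc : point -> line -> bool;
  point_nonempty : 0 < #|point|;
  line_nonempty : 0 < #|line|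
}.

Definition partial_linear_space (S : incidence_structure) : Prop :=
  forall (x y : point S) (l l' : line S), x != y ->
    inc x l -> inc y l -> inc x l' -> inc y l' -> l = l'.

Definition meets (S : incidence_structure) (l l' : line S) : bool :=
  [exists y, inc y l && inc y l'].

Definition partial_geometry (S : incidence_structure) (s t alpha : nat) : Prop :=
  [/\ [/\ 0 < s, 0 < t & 0 < alpha],
      partial_linear_space S,
      forall l : line S, #|[set x | inc x l]| = s + 1,
      forall x : point S, #|[set l | inc x l]| = t + 1
    & forall (l : line S) (x : point S), ~~ inc x l ->
        #|[set l' | inc x l' & meets l' l]| = alpha].

Section CollinearityGraph.
Variable S : incidence_structure.
Definition collinear : rel (point S) :=
  fun x y => (x != y) && [exists l, inc x l && inc y l].
Lemma collinear_sym : symmetric collinear.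
Proof.
move=> x y; rewrite /collinear eq_sym; congr (_ && _).
by apply: eq_existsb => l; rewrite andbC.
Qed.
Lemma collinear_irrefl : irreflexive collinear.
Proof. by move=> x; rewrite /collinear eqxx. Qed.
Definition collinearity_graph : sgraph :=
  SGraph collinear collinear_sym collinear_irrefl.
End CollinearityGraph.

Definition is_pg_graph (G : sgraph) (s t alpha : nat) : Prop :=
  exists2 S : incidence_structure,
    partial_geometry S s t alpha & isomorphic G (collinearity_graph S).

Definition orthogonal_array (m n : nat) (A : 'M['I_n]_(m, n ^ 2)) : Prop :=
  forall i j : 'I_m, i != j -> injective (fun c => (A i c, A j c)).

(* Columns are represented by their indices.  For m >= 2, distinct columns of
   an orthogonal array agree in at most one position. *)
Section ColumnGraph.
Variables (m n : nat) (A : 'M['I_n]_(m, n ^ 2)).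
Definition column_adj : rel 'I_(n ^ 2) :=
  fun c d => (c != d) && [exists i, A i c == A i d].
Lemma column_sym : symmetric column_adj.
Proof.
move=> c d; rewrite /column_adj eq_sym; congr (_ && _).
by apply: eq_existsb => i; rewrite eq_sym.
Qed.
Lemma column_irrefl : irreflexive column_adj.
Proof. by move=> c; rewrite /column_adj eqxx. Qed.
Definition column_graph : sgraph := SGraph column_adj column_sym column_irrefl.
End ColumnGraph.

Definition is_latin_square_graph (G : sgraph) (m n : nat) : Prop :=
  exists2 A : 'M['I_n]_(m, n ^ 2),
    orthogonal_array A & isomorphic G (column_graph A).

(* t-(V, m, l) designs without repeated blocks; for t = 2 and l = 1 repeated
   blocks are impossible anyway. *)
Definition design (P : finType) (B : {set {set P}}) (t V m l : nat) : Prop :=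
  [/\ t <= m <= V,
      #|P| = V,
      forall b, b \in B -> #|b| = m
    & forall X : {set P}, #|X| = t -> #|[set b in B | X \subset b]| = l].

Section BlockGraph.
Variables (P : finType) (B : {set {set P}}).
Definition block_adj : rel {b : {set P} | b \in B} :=
  fun b c => (b != c) && (val b :&: val c != set0).
Lemma block_sym : symmetric block_adj.
Proof. by move=> b c; rewrite /block_adj eq_sym setIC. Qed.
Lemma block_irrefl : irreflexive block_adj.
Proof. by move=> b; rewrite /block_adj eqxx. Qed.
Definition block_graph : sgraph := SGraph block_adj block_sym block_irrefl.
End BlockGraph.

Definition is_design_block_graph (G : sgraph) (t V m l : nat) : Prop :=
  exists (P : finType) (B : {set {set P}}),
    design B t V m l /\ isomorphic G (block_graph B).

Definition fbound (m mu : nat) : rat :=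
  (8%:R / 3%:R * m%:R * (mu%:R - 1) - 2%:R / 3%:R * mu%:R + 3%:R * m%:R
   - 10%:R / 3%:R)%R.

(* Main.v *)
Require Import Defs.
From mathcomp Require Import all_boot all_order all_algebra all_field.
From mathcomp Require Import zify ring lra.

Set Implicit Arguments.
Unset Strict Implicit.
Unset Printing Implicit Defensive.
Import Order.TTheory GRing.Theory Num.Theory.

(** Write A for the adjacency matrix. When lambda exceeds the bound, the graph is shown to be
    the collinearity graph of a partial geometry pg(s, m - 1, alpha) with mu = m alpha, and a
    partial geometry with alpha < t is shown to have s too small for this. Only
    alpha = t and alpha = t + 1 remain, that is mu = m (m - 1) and mu = m^2; then the partial
    geometry is a net, giving an orthogonal array, or the dual of a 2-design.

    Lines. In the neighbourhood of a vertex, non-adjacent vertices have at most mu - 1 common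
    neighbours. Counting the closed neighbourhoods of the leaves of a claw
    ([claw_bound]) gives k >= c (lambda + 1) - C(c,2) (mu - 1) for a claw with c leaves. The
    constant 8/3 makes this fail at c = m + (m - 1)/3, rounded up, so every claw is smaller.
    As in the work of Bruck, Bose and Metsch, every edge then lies in exactly one
    large maximal clique ([grand_clique_exists], [grand_clique_unique]). These are the lines.

    Regularity of the lines. Let N be the incidence matrix of vertices and lines, let d be
    the diagonal matrix of the numbers of lines on a vertex minus m, and let Q be the
    projection onto the eigenspace of -m, scaled to have diagonal 1. Since N N^T = A + m I + d,
    Q N N^T = Q d, and comparing the trace of the square on both sides, the squared Frobenius
    norm of N^T Q N is the sum of d_x d_y Q_xy^2. On the left-hand side a line K contributes at
    least the square of |K| (1 - m (|K| - 1) / k), and the quantities in parentheses add up to d_x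
    over the lines on x. As lines are large and rows of Q have small norm, this forces
    d = 0 and Q N = 0 ([line_deg_eq], [line_size_eq], [line_nbrs]), which are the axioms of a
    partial geometry.

    Partial geometries with alpha < t. The projection onto the kernel of N, acting on the lines,
    is a combination of the identity, the adjacency matrix of the line graph and the all-one
    matrix. Positivity of the sum of the cubes of its entries is a Krein condition
    ([krein_pg]), and its small rank bounds the number of lines by an absolute bound
    ([absolute_pg]). Together they give 3 s < 8 t^2 alpha ([pg_bound]). *)

(** * Quadratic forms on the lines of an incidence structure *)

Section LineForms.
Local Open Scope ring_scope.

(** The Cauchy-Schwarz inequality against a constant vector. *)
Lemma sqr_sum_le (R : realDomainType) (I : finType) (A : {set I}) (F : I -> R) :
  (\sum_(i in A) F i) ^+ 2 <= #|A|%:R * \sum_(i in A) F i ^+ 2.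
Proof.
(* Both sides come from the sum of (F i - F j)^2 over all pairs. *)
have h : 0 <= \sum_(i in A) \sum_(j in A) (F i - F j) ^+ 2.
  by apply: sumr_ge0 => i _; apply: sumr_ge0 => j _; exact: sqr_ge0.
have e : \sum_(i in A) \sum_(j in A) (F i - F j) ^+ 2 =
   2%:R * (#|A|%:R * \sum_(i in A) F i ^+ 2 - (\sum_(i in A) F i) ^+ 2).
  transitivity (\sum_(i in A) (#|A|%:R * F i ^+ 2 + \sum_(j in A) F j ^+ 2
                  - 2%:R * F i * \sum_(j in A) F j)).
    apply: eq_bigr => i _.
    rewrite mulr_sumr mulr_natl -sumr_const -big_split -sumrB /=.
    by apply: eq_bigr => j _; ring.
  rewrite sumrB big_split /= -mulr_suml sumr_const -[_ *+ #|A|]mulr_natl -!mulr_sumr.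
  ring.
by move: h; rewrite e pmulr_rge0 // subr_ge0.
Qed.

Variables (R : realFieldType) (P L : finType) (inc : P -> L -> bool).
Variables (Q : P -> P -> R) (d : P -> R).

(** With N the incidence matrix of points and lines, [Qinc] says that
    Q N N^T = Q D for the diagonal matrix D with entries [d]. *)
Hypothesis Qsym : forall x y, Q x y = Q y x.
Hypothesis Qinc : forall x y,
  \sum_z Q x z * #|[set l | inc z l & inc y l]|%:R = Q x y * d y.

(** The entry (x, l) of the matrix Q N. *)
Definition line_sum x l := \sum_(y | inc y l) Q x y.

(** The entries of N N^T. *)
Lemma natr_sum_joint x y :
  #|[set l | inc x l & inc y l]|%:R = \sum_l ((inc x l)%:R * (inc y l)%:R) :> R.
Proof.
rewrite -sum1_card natr_sum big_mkcond /=; apply: eq_bigr => l _.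
by rewrite inE; case: (inc x l); case: (inc y l); rewrite ?mulr0 ?mul0r ?mul1r.
Qed.

Lemma line_sumE x l : line_sum x l = \sum_y Q x y * (inc y l)%:R.
Proof.
rewrite /line_sum big_mkcond; apply: eq_bigr => y _.
by case: (inc y l); rewrite ?mulr1 ?mulr0.
Qed.

Lemma sum_line_sum x y : \sum_l line_sum x l * (inc y l)%:R = Q x y * d y.
Proof.
rewrite -Qinc.
under eq_bigr => l _ do rewrite line_sumE mulr_suml.
rewrite exchange_big; apply: eq_bigr => z _ /=.
by rewrite natr_sum_joint mulr_sumr; apply: eq_bigr => l _; rewrite mulrA.
Qed.

(** The entries of Q N N^T Q = Q D Q. *)
Lemma sum_line_sum_mul x x' :
  \sum_l line_sum x l * line_sum x' l = \sum_y Q x y * Q x' y * d y.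
Proof.
under eq_bigr => l _ do rewrite [line_sum x' l]line_sumE mulr_sumr.
rewrite exchange_big; apply: eq_bigr => y _ /=.
transitivity (Q x' y * \sum_l line_sum x l * (inc y l)%:R).
  by rewrite mulr_sumr; apply: eq_bigr => l _; ring.
by rewrite sum_line_sum; ring.
Qed.

Lemma sum_line_sum_indicator l l' :
  \sum_(x | inc x l) line_sum x l' = \sum_x line_sum x l' * (inc x l)%:R.
Proof.
rewrite big_mkcond; apply: eq_bigr => y _.
by case: (inc y l); rewrite ?mulr1 ?mulr0.
Qed.

(** The squared Frobenius norm of N^T Q N is tr(Q N N^T Q N N^T) = tr(Q D Q D). *)
Lemma sum_sqr_line_form :
  \sum_l \sum_l' (\sum_(x | inc x l) line_sum x l') ^+ 2 =
  \sum_x \sum_y d x * d y * Q x y ^+ 2.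
Proof.
transitivity (\sum_x \sum_x' #|[set l | inc x l & inc x' l]|%:R *
               \sum_l' line_sum x l' * line_sum x' l').
  transitivity (\sum_l \sum_l' \sum_x \sum_x'
     ((inc x l)%:R * (inc x' l)%:R) * (line_sum x l' * line_sum x' l')).
    apply: eq_bigr => l _; apply: eq_bigr => l' _.
    rewrite sum_line_sum_indicator expr2 mulr_suml; apply: eq_bigr => x _.
    by rewrite mulr_sumr; apply: eq_bigr => x' _; ring.
  under eq_bigr => l _ do rewrite exchange_big.
  rewrite exchange_big; apply: eq_bigr => x _ /=.
  under eq_bigr => l _ do rewrite exchange_big.
  rewrite exchange_big; apply: eq_bigr => x' _ /=.
  rewrite natr_sum_joint mulr_suml; apply: eq_bigr => l _.
  by rewrite mulr_sumr.
under eq_bigr => x _ do under eq_bigr => x' _ do rewrite sum_line_sum_mul mulr_sumr.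
under eq_bigr => x _ do rewrite exchange_big.
rewrite exchange_big [RHS]exchange_big; apply: eq_bigr => y _ /=.
apply: eq_bigr => x _.
transitivity (d y * Q x y * \sum_x' Q y x' * #|[set l | inc x' l & inc x l]|%:R).
  rewrite mulr_sumr; apply: eq_bigr => x' _.
  rewrite (Qsym x' y) (_ : [set l | inc x l & inc x' l] = [set l | inc x' l & inc x l]).
    by ring.
  by apply/setP => l; rewrite !inE andbC.
by rewrite Qinc (Qsym y x); ring.
Qed.

End LineForms.

(** * Line systems in a graph with eigenvalue -m *)

Section SpectralForm.
Local Open Scope ring_scope.

(** The equation [param] says that -m is a root of
    X^2 + (mu - lambda) X + (mu - k). *)
Variables (G : sgraph) (k lambda mu m : nat).
Hypothesis deg : forall x : G, #|[set y | adj x y]| = k.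
Hypothesis cn_adj : forall x y : G, adj x y -> #|common_neighbours x y| = lambda.
Hypothesis cn_nadj : forall x y : G, x != y -> ~~ adj x y ->
  #|common_neighbours x y| = mu.
Hypothesis param : (k + m * mu = mu + m * (lambda + m))%N.
Hypothesis k_gt0 : (0 < k)%N.
Hypothesis mu_le : (mu <= lambda + m)%N.

(** One plus the second root theta = lambda - mu + m of this polynomial. *)
Definition thetaS : rat := (lambda + m + 1)%:R - mu%:R.
(** The entry of [proj] at a pair of distinct non-adjacent vertices. *)
Definition eps : rat := mu%:R / (k%:R * thetaS).
(** The entries of the adjacency matrix A and of the identity matrix. *)
Definition adjR (x y : G) : rat := (adj x y)%:R.
Definition eqR (x y : G) : rat := (x == y)%:R.

(** The orthogonal projection onto the eigenspace of -m, scaled to have diagonal 1. *)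
Definition proj (x y : G) : rat :=
  eqR x y - m%:R / k%:R * adjR x y + eps * (1 - eqR x y - adjR x y).

Lemma proj_sym x y : proj x y = proj y x.
Proof. by rewrite /proj /adjR /eqR eq_sym adj_sym. Qed.

Lemma projxx x : proj x x = 1.
Proof. by rewrite /proj /adjR /eqR eqxx adj_irrefl /=; ring. Qed.

Lemma proj_adj x y : adj x y -> proj x y = - (m%:R / k%:R).
Proof.
move=> a; rewrite /proj /adjR /eqR a.
have -> : (x == y) = false by apply/eqP => e; rewrite e adj_irrefl in a.
by rewrite /=; ring.
Qed.

Lemma thetaS_gt0 : 0 < thetaS.
Proof.
rewrite /thetaS subr_gt0 ltr_nat; lia.
Qed.

Lemma kR_gt0 : 0 < k%:R :> rat.
Proof. by rewrite ltr0n. Qed.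

Lemma paramR : k%:R = mu%:R + m%:R * (thetaS - 1) :> rat.
Proof.
have := congr1 (fun n => n%:R : rat) param.
rewrite /thetaS !natrD !natrM natrD /=; lra.
Qed.

Lemma epsE : eps * k%:R * thetaS = mu%:R.
Proof.
rewrite /eps; have := thetaS_gt0; have := kR_gt0; move=> h1 h2.
by field; rewrite !gt_eqF.
Qed.

Lemma sum_adjR x : \sum_y adjR x y = k%:R.
Proof.
rewrite -(deg x) -sum1_card natr_sum [RHS]big_mkcond /=; apply: eq_bigr => y _.
by rewrite inE /adjR; case: (adj x y).
Qed.

(** The entries of A^2. *)
Lemma sum_adjR2 x y : \sum_z adjR x z * adjR z y = #|common_neighbours x y|%:R.
Proof.
rewrite -sum1_card natr_sum [RHS]big_mkcond /=; apply: eq_bigr => z _.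
rewrite inE /adjR (adj_sym z y).
by case: (adj x z); case: (adj y z); rewrite ?mulr0 ?mul0r ?mul1r.
Qed.

Lemma sum_eqR x (F : G -> rat) : \sum_z eqR x z * F z = F x.
Proof.
rewrite (bigD1 x) //= /eqR eqxx mul1r big1 ?addr0 // => z.
by rewrite eq_sym => /negbTE ->; rewrite mul0r.
Qed.

(** The rows of [proj] are eigenvectors of A for the eigenvalue -m. *)
Lemma proj_adjR x y : \sum_z proj x z * adjR z y = - m%:R * proj x y.
Proof.
have -> : \sum_z proj x z * adjR z y =
    (1 - eps) * \sum_z eqR x z * adjR z y
    - (m%:R / k%:R + eps) * \sum_z adjR x z * adjR z y + eps * \sum_z adjR y z.
  rewrite !mulr_sumr -sumrB -big_split /=; apply: eq_bigr => z _.
  by rewrite /proj /adjR (adj_sym y z); ring.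
rewrite sum_eqR sum_adjR2 sum_adjR.
have h1 := thetaS_gt0; have h2 := kR_gt0; have h3 := paramR.
have [e|ne] := eqVneq x y.
  rewrite -e (_ : common_neighbours x x = [set z | adj x z]); last first.
    by apply/setP => z; rewrite !inE andbb.
  by rewrite deg projxx /adjR adj_irrefl /=; field; rewrite gt_eqF.
have e4 : lambda%:R = mu%:R + (thetaS - 1) - m%:R :> rat.
  by rewrite /thetaS !natrD; ring.
have [a|na] := boolP (adj x y).
  rewrite cn_adj // proj_adj // /adjR a /= /eps e4 h3.
  have : k%:R != 0 :> rat by rewrite gt_eqF.
  by rewrite h3 => h; field; rewrite h gt_eqF.
rewrite cn_nadj // /proj /adjR /eqR (negbTE na) (negbTE ne) /= /eps h3.
have : k%:R != 0 :> rat by rewrite gt_eqF.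
by rewrite h3 => h; field; rewrite h gt_eqF.
Qed.

Lemma sum_proj x : (0 < m)%N -> \sum_y proj x y = 0.
Proof.
move=> m0.
have : \sum_y \sum_z proj x z * adjR z y = - m%:R * \sum_y proj x y.
  by rewrite mulr_sumr; apply: eq_bigr => y _; rewrite proj_adjR.
rewrite exchange_big /=.
under eq_bigr => z _ do rewrite -mulr_sumr sum_adjR.
rewrite -mulr_suml => h; apply/eqP.
have : (k + m)%:R * (\sum_y proj x y) = 0 :> rat.
  by rewrite natrD mulrDl mulrC h; ring.
by move/eqP; rewrite mulf_eq0 pnatr_eq0 => /orP [|//]; lia.
Qed.

Lemma sum_sqr_proj x : (0 < m)%N ->
  \sum_y proj x y ^+ 2 = 1 + m%:R ^+ 2 / k%:R + (m%:R - 1) * eps.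
Proof.
move=> m0.
have e2 : \sum_y (1 - eqR x y - adjR x y) * eps = m%:R - 1.
  have := sum_proj x m0.
  have -> : \sum_y proj x y = \sum_y eqR x y * 1 - m%:R / k%:R * \sum_y adjR x y
     + \sum_y (1 - eqR x y - adjR x y) * eps.
    rewrite !mulr_sumr -sumrB -big_split /=; apply: eq_bigr => z _.
    by rewrite /proj; ring.
  rewrite sum_eqR sum_adjR divfK; last by rewrite gt_eqF // kR_gt0.
  move=> h; lra.
have -> : \sum_y proj x y ^+ 2 = \sum_y eqR x y * 1 +
   (m%:R / k%:R) ^+ 2 * \sum_y adjR x y
   + \sum_y (1 - eqR x y - adjR x y) * eps * eps.
  rewrite !mulr_sumr -!big_split /=; apply: eq_bigr => z _.
  rewrite /proj /eqR /adjR; have [<-|ne] := eqVneq x z.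
    by rewrite adj_irrefl /=; ring.
  by case: (adj x z) => /=; ring.
by rewrite sum_eqR sum_adjR -mulr_suml e2; field; rewrite gt_eqF // kR_gt0.
Qed.

(** A system of lines, all of size at least [g], such that every edge is on exactly one
    line and the points of a line are pairwise adjacent. *)
Variables (L : finType) (inc : G -> L -> bool) (g : nat).
Hypothesis m_gt0 : (0 < m)%N.
Hypothesis joint : forall x y : G, x != y ->
  #|[set l | inc x l & inc y l]| = adj x y.
Hypothesis g_le : forall l, (g <= #|[set x | inc x l]|)%N.
Hypothesis g_large : ((k + m ^ 2) * (lambda + m + 1 - mu) + (m - 1) * mu
   < g * (g - 1) * (lambda + m + 1 - mu))%N.

(* The size of a line, the excess over m of the number of lines on a point, and the defect
   of the size of a line relative to the Delsarte value 1 + k / m. *)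
Let size l : rat := #|[set x | inc x l]|%:R.
Let d (x : G) : rat := #|[set l | inc x l]|%:R - m%:R.
Let delta l : rat := 1 - m%:R / k%:R * (size l - 1).

(** Here N N^T = A + diag(number of lines on x), and [proj] kills A + m I. *)
Lemma proj_joint x y :
  \sum_z proj x z * #|[set l | inc z l & inc y l]|%:R = proj x y * d y.
Proof.
transitivity (\sum_z (proj x z * adjR z y +
   eqR y z * (proj x z * #|[set l | inc z l]|%:R))).
  apply: eq_bigr => z _; rewrite /eqR; have [->|ne] := eqVneq y z.
    rewrite /adjR adj_irrefl mulr0 add0r mul1r; congr (_ * _%:R).
    by apply: eq_card => l; rewrite !inE andbb.
  by rewrite joint 1?eq_sym // mul0r addr0.
by rewrite big_split /= proj_adjR sum_eqR /d; ring.
Qed.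

Lemma adj_on_line x y l : x != y -> inc x l -> inc y l -> adj x y.
Proof.
move=> ne hx hy; have := joint ne; case: (adj x y) => // /eqP.
by rewrite cards_eq0 => /eqP/setP/(_ l); rewrite !inE hx hy.
Qed.

Lemma sum_proj_line x l : inc x l -> \sum_(y | inc y l) proj x y = delta l.
Proof.
move=> hx; rewrite (bigD1 x) //= projxx /delta.
rewrite (eq_bigr (fun=> - (m%:R / k%:R))); last first.
  by move=> y /andP [hy ne]; rewrite proj_adj // (adj_on_line _ hx hy) // eq_sym.
rewrite sumr_const /size -mulr_natr.
have -> : #|[set x | inc x l]| = (1 + #|[pred y | inc y l & y != x]|)%N.
  rewrite (cardD1 x) inE hx; congr (_ + _)%N.
  by apply: eq_card => y; rewrite !inE andbC.
by rewrite natrD; ring.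
Qed.

Lemma line_form_diag l :
  \sum_(x | inc x l) line_sum inc proj x l = size l * delta l.
Proof.
rewrite (eq_bigr (fun=> delta l)); last by move=> x hx; exact: sum_proj_line.
rewrite sumr_const -mulr_natl /size; congr (_%:R * _).
by apply: eq_card => x; rewrite inE.
Qed.

Lemma sum_size x : \sum_(l | inc x l) (size l - 1) = k%:R.
Proof.
transitivity (\sum_(l | inc x l) \sum_(y | (y != x) && inc y l) (1 : rat)).
  apply: eq_bigr => l hl.
  rewrite sumr_const /size (cardsD1 x) inE hl natrD addrAC subrr add0r.
  by congr (_%:R); apply: eq_card => y; rewrite !inE.
rewrite (exchange_big_dep (fun y => y != x)) /=; last by move=> ? ? _ /andP [].
rewrite -(sum_adjR x) [RHS](bigD1 x) //= /adjR adj_irrefl add0r.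
apply: eq_bigr => y ne.
rewrite sumr_const; congr (_%:R).
rewrite -joint 1?eq_sym //; apply: eq_card => l.
by rewrite inE unfold_in /= eq_sym ne.
Qed.

(** The defects of the lines on a point add up to its excess. *)
Lemma sum_delta x : \sum_(l | inc x l) delta l = d x.
Proof.
rewrite /delta sumrB -mulr_sumr sum_size divfK; last by rewrite gt_eqF // kR_gt0.
by rewrite sumr_const /d; congr (_%:R - _); apply: eq_card => l; rewrite inE.
Qed.

Lemma g_gt1 : (1 < g)%N.
Proof. by move: g_large; case: (g) => [|[|//]]; rewrite ?subnn ?muln0 ?mul0n ltn0. Qed.

Lemma line_deg_le x : #|[set l | inc x l]|%:R * (g%:R - 1) <= k%:R :> rat.
Proof.
rewrite -(sum_size x) mulr_natl -sumr_const.
rewrite [X in X <= _](eq_bigl (inc x)); last by move=> l; rewrite inE.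
by apply: ler_sum => l _; rewrite lerB // ler_nat.
Qed.

Lemma sqr_d_le x : (g%:R - 1) * d x ^+ 2 <= k%:R * \sum_(l | inc x l) delta l ^+ 2.
Proof.
have h := @sqr_sum_le rat L [set l | inc x l] delta.
have e (F : L -> rat) : \sum_(l in [set l | inc x l]) F l = \sum_(l | inc x l) F l.
  by apply: eq_bigl => l; rewrite inE.
rewrite !e sum_delta in h.
have g1 : 0 <= g%:R - 1 :> rat by rewrite subr_ge0 ler1n; have := g_gt1; lia.
apply: (le_trans (ler_wpM2l g1 h)); rewrite mulrA.
apply: ler_wpM2r; first by apply: sumr_ge0 => l _; exact: sqr_ge0.
by rewrite mulrC line_deg_le.
Qed.

(* The diagonal part of the squared norm of N^T proj N, and the squared norm of the
   vector of excesses. *)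
Let S2 : rat := \sum_l (size l * delta l) ^+ 2.
Let D2 : rat := \sum_x d x ^+ 2.

Lemma S2_ge : g%:R * (g%:R - 1) * D2 <= k%:R * S2.
Proof.
have -> : S2 = \sum_x \sum_(l | inc x l) size l * delta l ^+ 2.
  rewrite (exchange_big_dep predT) //=; apply: eq_bigr => l _.
  rewrite sumr_const -mulr_natl /size exprMn mulrA; congr (_ * _).
  by rewrite expr2; congr (_%:R * _); apply: eq_card => x; rewrite inE.
rewrite /D2 !mulr_sumr; apply: ler_sum => x _.
rewrite -mulrA.
apply: (le_trans (ler_wpM2l (ler0n _ g) (sqr_d_le x))).
rewrite mulrCA ler_wpM2l ?ler0n // mulr_sumr.
by apply: ler_sum => l _; rewrite ler_wpM2r ?sqr_ge0 // /size ler_nat.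
Qed.

(** By [sum_sqr_line_form], S2 is at most the sum of d x * d y * (proj x y)^2, and a
    product d x * d y is at most the mean of the two squares. *)
Lemma S2_le : S2 <= (1 + m%:R ^+ 2 / k%:R + (m%:R - 1) * eps) * D2.
Proof.
apply: (@le_trans _ _ (\sum_x \sum_y d x * d y * proj x y ^+ 2)).
  rewrite -(sum_sqr_line_form proj_sym proj_joint) /S2.
  apply: ler_sum => l _; rewrite -line_form_diag.
  rewrite (bigD1 l) //= lerDl; apply: sumr_ge0 => ? _; exact: sqr_ge0.
apply: (@le_trans _ _ (\sum_x \sum_y (d x ^+ 2 + d y ^+ 2) / 2%:R * proj x y ^+ 2)).
  apply: ler_sum => x _; apply: ler_sum => y _; apply: ler_wpM2r; first exact: sqr_ge0.
  have := sqr_ge0 (d x - d y); nra.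
under eq_bigr => x _ do under eq_bigr => y _ do rewrite 2!mulrDl.
under eq_bigr => x _ do rewrite big_split /=.
rewrite big_split /= [X in _ + X]exchange_big /= le_eqVlt; apply/orP; left; apply/eqP.
rewrite /D2 mulr_sumr -big_split /=; apply: eq_bigr => x _.
under [X in _ + X]eq_bigr => y _ do rewrite proj_sym.
rewrite -mulr_sumr sum_sqr_proj //.
by field; rewrite gt_eqF // kR_gt0.
Qed.

(** The two bounds on S2 contradict [g_large] unless all excesses vanish. *)
Lemma D2_eq0 : D2 = 0.
Proof.
have D2ge0 : 0 <= D2 by apply: sumr_ge0 => x _; exact: sqr_ge0.
have h1 := S2_ge; have h2 := S2_le.
have kk := kR_gt0; have tt := thetaS_gt0.
have h3 : k%:R * S2 * thetaS <=
   ((k%:R + m%:R ^+ 2) * thetaS + (m%:R - 1) * mu%:R) * D2.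
  rewrite -epsE.
  have := ler_wpM2l (ltW (mulr_gt0 kk tt)) h2; rewrite mulrAC.
  suff -> : k%:R * thetaS * ((1 + m%:R ^+ 2 / k%:R + (m%:R - 1) * eps) * D2) =
    ((k%:R + m%:R ^+ 2) * thetaS + (m%:R - 1) * (eps * k%:R * thetaS)) * D2 by [].
  by field; rewrite gt_eqF.
have h4 := ler_wpM2r (ltW tt) h1.
have h5 := le_trans h4 h3.
have h6 : ((k%:R + m%:R ^+ 2) * thetaS + (m%:R - 1) * mu%:R) < g%:R * (g%:R - 1) * thetaS.
  have g1 := g_gt1.
  have e1 : thetaS = (lambda + m + 1 - mu)%:R.
    by rewrite /thetaS -natrB //; lia.
  move: g_large; rewrite e1.
  have -> : (g%:R - 1 : rat) = (g - 1)%:R by rewrite natrB //; lia.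
  have -> : (m%:R - 1 : rat) = (m - 1)%:R by rewrite natrB.
  by rewrite -natrX -!(natrD, natrM) ltr_nat.
apply/eqP; rewrite eq_le D2ge0 andbT; rewrite leNgt; apply/negP => Dpos.
have : ((k%:R + m%:R ^+ 2) * thetaS + (m%:R - 1) * mu%:R) * D2 <
   g%:R * (g%:R - 1) * thetaS * D2 by rewrite ltr_pM2r.
rewrite ltNge => /negP; apply.
by move: h5; rewrite mulrAC.
Qed.

Lemma d_eq0 x : d x = 0.
Proof.
have := D2_eq0; move/eqP; rewrite psumr_eq0; last by move=> *; exact: sqr_ge0.
by move/allP/(_ x (mem_index_enum _)); rewrite sqrf_eq0 => /eqP.
Qed.

Lemma line_deg_eq x : #|[set l | inc x l]| = m.
Proof.
have /eqP := d_eq0 x; rewrite /d subr_eq0 eqr_nat => /eqP; exact.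
Qed.

(** With d = 0 the rows of proj N have norm 0. *)
Lemma line_sum_eq0 x l : line_sum inc proj x l = 0.
Proof.
have : \sum_l line_sum inc proj x l * line_sum inc proj x l = 0.
  rewrite (sum_line_sum_mul proj_joint) big1 // => y _.
  by rewrite d_eq0 mulr0.
move/eqP; rewrite psumr_eq0; last by move=> i _; rewrite -expr2 sqr_ge0.
by move/allP/(_ l (mem_index_enum _)); rewrite mulf_eq0 orbb => /eqP.
Qed.

Lemma line_size_eq l : (m * (#|[set x | inc x l]| - 1) = k)%N.
Proof.
have gs := g_le l; have g1 := g_gt1.
have [x] : exists x, x \in [set x | inc x l].
  by apply/set0Pn; rewrite -card_gt0; lia.
rewrite inE => hx.
have := line_sum_eq0 x l; rewrite /line_sum sum_proj_line // /delta.
move=> h; apply/eqP; rewrite -(eqr_nat rat) natrM natrB; last by lia.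
apply/eqP; have kk := kR_gt0.
have : k%:R * (1 - m%:R / k%:R * (size l - 1)) = 0 :> rat by rewrite h mulr0.
rewrite mulrBr mulr1 mulrA mulrCA mulfV ?gt_eqF // mulr1 => /eqP.
by rewrite subr_eq0 => /eqP ->.
Qed.

Lemma line_nbrs z l : ~~ inc z l ->
  (m * #|[set y | inc y l & adj z y]| = mu)%N.
Proof.
move=> nz; have := line_sum_eq0 z l.
set j := #|_|.
have -> : line_sum inc proj z l = - (m%:R / k%:R + eps) * j%:R + eps * size l.
  rewrite /line_sum (eq_bigr (fun y => - (m%:R / k%:R + eps) * adjR z y + eps)).
    rewrite big_split /= -mulr_sumr sumr_const -[eps *+ _]mulr_natr; congr (_ * _ + _ * _%:R).
      rewrite /j -sum1_card natr_sum big_mkcond [RHS]big_mkcond /=.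
      apply: eq_bigr => y _; rewrite inE /adjR.
      by case: (inc y l); case: (adj z y).
    by apply: eq_card => y; rewrite inE.
  move=> y hy; rewrite /proj /eqR.
  have -> : (z == y) = false by apply/eqP => e; rewrite e hy in nz.
  by rewrite /=; ring.
have := line_size_eq l; move=> hs.
have gs := g_le l; have g1 := g_gt1.
have : m%:R * (size l - 1) = k%:R.
  by rewrite -hs natrM natrB //; lia.
have kk := kR_gt0; have tt := thetaS_gt0; have pp := paramR.
have mm : 0 < m%:R :> rat by rewrite ltr0n.
move=> es h; apply/eqP; rewrite -(eqr_nat rat) natrM; apply/eqP.
have sE : size l = (k%:R + m%:R) / m%:R by rewrite -es; field; rewrite gt_eqF.
move: h; rewrite sE /eps => h.
have : (m%:R * j%:R - mu%:R) * (m%:R * thetaS + mu%:R) = 0.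
  transitivity (- (m%:R * k%:R * thetaS) * (- (m%:R / k%:R + mu%:R / (k%:R * thetaS)) * j%:R +
    mu%:R / (k%:R * thetaS) * ((k%:R + m%:R) / m%:R))); last by rewrite h mulr0.
  transitivity (m%:R * j%:R * (m%:R * thetaS + mu%:R) - mu%:R * (k%:R + m%:R)).
    by rewrite pp; ring.
  by field; rewrite !gt_eqF.
move/eqP; rewrite mulf_eq0 => /orP []; first by rewrite subr_eq0 => /eqP.
have : 0 < m%:R * thetaS + mu%:R by rewrite ltr_pwDl ?mulr_gt0 ?ler0n.
by move=> ?; rewrite gt_eqF.
Qed.

End SpectralForm.

(** * Claws and grand cliques *)

Lemma leq_card_bigcup (I T : finType) (A : {set I}) (F : I -> {set T}) (n : nat) :
  (forall i, i \in A -> #|F i| <= n) -> #|\bigcup_(i in A) F i| <= #|A| * n.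
Proof.
move=> h; rewrite -sum_nat_const.
elim/big_rec2: _ => [|i y1 y2 iA hy]; first by rewrite cards0.
by rewrite (leq_trans (leq_card_setU _ _)) // leq_add ?h.
Qed.

Section GrandCliques.
Variables (G : sgraph) (lambda M s : nat).
Hypothesis cn_adj : forall x y : G, adj x y -> #|common_neighbours x y| = lambda.
Hypothesis cn_nadj : forall x y : G, x != y -> ~~ adj x y ->
  #|common_neighbours x y| <= M.+1.

(** The open neighbourhood of a vertex, cliques (sets of pairwise adjacent vertices), and
    cocliques (sets of pairwise non-adjacent vertices). *)
Definition nbhd (x : G) : {set G} := [set y | adj x y].
Definition clique (K : {set G}) : bool :=
  [forall x in K, forall y in K, (x != y) ==> adj x y].
Definition coclique (Y : {set G}) : bool :=
  [forall x in Y, forall y in Y, ~~ adj x y].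

Lemma cliqueP (K : {set G}) :
  reflect (forall x y, x \in K -> y \in K -> x != y -> adj x y) (clique K).
Proof.
apply: (iffP forall_inP) => [h x y hx hy | h x hx].
  by move/forall_inP: (h x hx) => /(_ y hy)/implyP.
by apply/forall_inP => y hy; apply/implyP; exact: h.
Qed.

Lemma cocliqueP (K : {set G}) :
  reflect (forall x y, x \in K -> y \in K -> ~~ adj x y) (coclique K).
Proof.
apply: (iffP forall_inP) => [h x y hx hy | h x hx].
  by move/forall_inP: (h x hx) => /(_ y hy).
by apply/forall_inP => y hy; exact: h.
Qed.

Lemma cocliqueU1 (w : G) (Y : {set G}) : coclique Y ->
  (forall y, y \in Y -> ~~ adj w y) -> coclique (w |: Y).
Proof.
move=> /cocliqueP cY h; apply/cocliqueP => x y.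
rewrite !in_setU1 => /orP [/eqP ->|hx] /orP [/eqP ->|hy].
- by rewrite adj_irrefl.
- exact: h.
- by rewrite adj_sym h.
- exact: cY.
Qed.

Lemma coclique_sub (Y Y' : {set G}) : Y' \subset Y -> coclique Y -> coclique Y'.
Proof.
move=> /subsetP sY /cocliqueP cY; apply/cocliqueP => x y hx hy.
by apply: cY; apply: sY.
Qed.

(** Inside the neighbourhood of [x], non-adjacent vertices have at most [M] common
    neighbours, because [x] itself is a further one. *)
Lemma cn_in_nbhd (x y z : G) : adj x y -> adj x z -> y != z -> ~~ adj y z ->
  #|common_neighbours y z :\ x| <= M.
Proof.
move=> xy xz ne na; have := cn_nadj ne na.
by rewrite (cardsD1 x) inE (adj_sym y) xy (adj_sym z) xz add1n ltnS.
Qed.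

Lemma card_closed_cn (x y : G) : adj x y -> #|y |: common_neighbours x y| = lambda.+1.
Proof.
by move=> xy; rewrite cardsU1 inE adj_irrefl andbF add1n cn_adj.
Qed.

(** Bonferroni's inequality for the closed neighbourhoods, inside the neighbourhood of [x],
    of the leaves of a claw with centre [x]. *)
Lemma claw_bound_aux (x : G) (n : nat) (Y : {set G}) : #|Y| = n ->
  Y \subset nbhd x -> coclique Y ->
  n * lambda.+1 <= #|\bigcup_(y in Y) (y |: common_neighbours x y)| + 'C(n, 2) * M.
Proof.
elim: n Y => [|n IH] Y cY sY iY; first by rewrite mul0n.
have [y hy] : exists y, y \in Y by apply/set0Pn; rewrite -card_gt0 cY.
have sY' := subD1set Y y.
have cY' : #|Y :\ y| = n by move: cY; rewrite (cardsD1 y) hy add1n => -[].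
have := IH _ cY' (subset_trans sY' sY) (coclique_sub sY' iY).
rewrite [in X in _ -> X](big_setD1 y) //=.
set W := \bigcup_(z in Y :\ y) _; set U := y |: _ => hI.
have xy : adj x y by move/subsetP: sY => /(_ y hy); rewrite inE.
have hU : #|U| = lambda.+1 by rewrite card_closed_cn.
have hUW : #|U :&: W| <= n * M.
  rewrite -cY' /W big_distrr /=; apply: leq_card_bigcup => z.
  rewrite !inE => /andP [zy hz].
  have xz : adj x z by move/subsetP: sY => /(_ z hz); rewrite inE.
  have nyz : ~~ adj y z by move/cocliqueP: iY; apply.
  apply: leq_trans (cn_in_nbhd xy xz _ nyz); last by rewrite eq_sym.
  apply: subset_leq_card; apply/subsetP => w; rewrite !inE.
  case: (eqVneq w y) => [->|_] /=.
    by rewrite eq_sym (negbTE zy) /= (adj_sym z y) (negbTE nyz) andbF.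
  case/andP => /andP [xw yw]; case: (eqVneq w z) => [e|_] /=.
    by rewrite e (negbTE nyz) in yw.
  case/andP => _ zw; rewrite yw zw !andbT.
  by apply/eqP => e; rewrite e adj_irrefl in xw.
have := cardsUI U W; rewrite binS bin1 mulnDl mulSn hU; lia.
Qed.

Lemma claw_bound (x : G) (Y : {set G}) (k n : nat) : #|nbhd x| = k ->
  Y \subset nbhd x -> coclique Y -> n <= #|Y| -> n * lambda.+1 <= k + 'C(n, 2) * M.
Proof.
move=> hk sY iY /card_geqP [q [uq sq subq]].
have sY' : [set y in q] \subset Y by apply/subsetP => y; rewrite inE; exact: subq.
have cY' : #|[set y in q]| = n by rewrite cardsE (card_uniqP uq).
apply: leq_trans (claw_bound_aux cY' (subset_trans sY' sY) (coclique_sub sY' iY)) _.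
rewrite leq_add2r -hk; apply: subset_leq_card; apply/bigcupsP => y hy.
move/subsetP: sY => /(_ y (subsetP sY' _ hy)) xy.
by apply/subsetP => w; rewrite !inE => /orP [/eqP ->|/andP []] //; move: xy; rewrite inE.
Qed.

Hypothesis claw_le : forall (x : G) (Y : {set G}),
  Y \subset nbhd x -> coclique Y -> #|Y| <= s.

(** The maximal cliques that are large enough to serve as lines. *)
Definition grand_clique (K : {set G}) : bool :=
  maxset clique K && (lambda + 2 <= #|K| + (s - 1) * M).

(** Among the largest cocliques of the neighbourhood of [x], let [Y] meet the closed
    neighbourhood of [z] in as few points as possible, and let [y] be one of these points.
    The neighbours [C] of [x] that could replace [y] in [Y] form a large clique. By the choice
    of [Y], all of them except [z] itself are adjacent to [z]. *)
Lemma grand_clique_exists (x z : G) : adj x z ->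
  exists2 K, grand_clique K & (x \in K) && (z \in K).
Proof.
move=> xz.
pose P (Y : {set G}) := (Y \subset nbhd x) && coclique Y.
have P0 : P set0 by rewrite /P sub0set; apply/cocliqueP => a b; rewrite inE.
case: (@arg_maxnP _ set0 P (fun Y => #|Y|) P0) => Y0 PY0 maxY0.
pose N := z |: nbhd z.
pose P' Y := P Y && (#|Y| == #|Y0|).
have P'0 : P' Y0 by rewrite /P' PY0 eqxx.
case: (@arg_minnP _ Y0 P' (fun Y => #|Y :&: N|) P'0) => Y /andP [PY /eqP cY] minY.
have maxY Y' : P Y' -> #|Y'| <= #|Y| by move=> h; rewrite cY; exact: maxY0.
have /andP [sY iY] := PY.
have [y] : exists y, y \in Y :&: N.
  apply/set0Pn; apply/negP => /eqP /setP e.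
  have nzY : z \notin Y.
    by move: (e z); rewrite !inE eqxx andbT => ->.
  suff : #|z |: Y| <= #|Y| by rewrite cardsU1 nzY add1n ltnn.
  apply: maxY; apply/andP; split; first by rewrite subUset sub1set inE xz.
  apply: cocliqueU1 => // w hw; move: (e w); rewrite !inE hw /= => /negbT.
  by rewrite negb_or => /andP [].
rewrite inE => /andP [hy yN].
have xy : adj x y by move/subsetP: sY => /(_ y hy); rewrite inE.
pose C := [set w in nbhd x | ((w == y) || adj w y) && [forall y' in Y :\ y, ~~ adj w y']].
have CP w : w \in C -> [/\ adj x w, (w == y) || adj w y &
   forall y', y' \in Y :\ y -> ~~ adj w y'].
  by rewrite !inE => /and3P [h1 h2 /forall_inP h3].
have sYy := subD1set Y y.
have iYy := coclique_sub sYy iY.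
have cYy : #|Y| = (#|Y :\ y|).+1 by rewrite (cardsD1 y) hy.
have nCY w : w \in C -> w \notin Y :\ y.
  move=> /CP [h1 h2 h3]; apply/negP => hw; have := hw; rewrite !inE => /andP [wy wY].
  move: h2; rewrite (negbTE wy) /=; apply/negP.
  by move/cocliqueP: iY; apply.
have PC w : w \in C -> P (w |: (Y :\ y)).
  move=> /CP [h1 h2 h3]; apply/andP; split.
    by rewrite subUset sub1set inE h1 (subset_trans sYy).
  exact: cocliqueU1.
have clC : clique C.
  apply/cliqueP => w w' hw hw' ne; apply/negPn/negP => na.
  have : #|w' |: (w |: (Y :\ y))| <= #|Y|.
    apply: maxY; have /andP [p1 p2] := PC _ hw; apply/andP; split.
      by rewrite subUset sub1set inE p1 andbT; have [] := CP _ hw'.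
    apply: cocliqueU1 => // v; rewrite in_setU1 => /orP [/eqP ->|hv].
      by rewrite adj_sym.
    by have [_ _] := CP _ hw'; apply.
  rewrite cardsU1 in_setU1 negb_or eq_sym ne (nCY _ hw') cardsU1 (nCY _ hw) cYy.
  by rewrite !add1n ltnn.
have zC w : w \in C -> w != z -> adj w z.
  move=> hw wz; apply/negPn/negP => na.
  have : #|Y :&: N| <= #|(w |: (Y :\ y)) :&: N|.
    apply: minY; rewrite /P' PC //= cardsU1 nCY //= add1n -cYy cY; exact: eqxx.
  rewrite leqNgt => /negP; apply; apply: proper_card; apply/properP; split.
    apply/subsetP => v; rewrite in_setI in_setU1 => /andP [/orP [/eqP ->|hv] vN].
      by move: vN; rewrite !inE (negbTE wz) /= (adj_sym z w) (negbTE na).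
    by rewrite in_setI vN andbT (subsetP sYy).
  exists y; rewrite in_setI ?hy ?yN // in_setU1 in_setD1 eqxx /= orbF.
  apply/negP => /andP [/eqP e _].
  by move: yN; rewrite e !inE (negbTE wz) /= (adj_sym z w) (negbTE na).
have cC : lambda.+1 <= #|C| + (s - 1) * M.
  rewrite -(card_closed_cn xy).
  have : y |: common_neighbours x y \subset
     C :|: \bigcup_(y' in Y :\ y) (common_neighbours y y' :\ x).
    apply/subsetP => w hw; rewrite in_setU.
    have [//|nC] := boolP (w \in C); apply/bigcupP.
    have xw : adj x w by move: hw; rewrite !inE => /orP [/eqP ->|/andP []].
    have wy : (w == y) || adj w y.
      by move: hw; rewrite !inE (adj_sym w) => /orP [->|/andP [_ ->]]; rewrite ?orbT.
    move: nC; rewrite !inE xw wy /= negb_forall => /existsP [y'].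
    rewrite negb_imply negbK => /andP [hy' wy'].
    exists y' => //; rewrite !inE (adj_sym y') wy' andbT.
    apply/andP; split; first by apply/eqP => e; rewrite e adj_irrefl in xw.
    case/orP: wy => [/eqP e|]; last by rewrite adj_sym.
    move: hy'; rewrite !inE => /andP [_ hy'].
    by move/cocliqueP: iY => /(_ _ _ hy hy'); rewrite -e wy'.
  move/subset_leq_card => h.
  apply: leq_trans h (leq_trans (leq_card_setU _ _) _); rewrite leq_add2l.
  apply: (@leq_trans (#|Y :\ y| * M)).
    apply: leq_card_bigcup => y'; rewrite !inE => /andP [ny hy'].
    apply: cn_in_nbhd => //; last by move/cocliqueP: iY; apply.
      by move/subsetP: sY => /(_ _ hy'); rewrite inE.
    by rewrite eq_sym.
  have := claw_le sY iY; rewrite cYy => h2.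
  by rewrite leq_mul2r leq_subRL ?add1n ?h2 ?orbT // (leq_trans _ h2).
have clK : clique (x |: (z |: C)).
  apply/cliqueP => a b; rewrite !in_setU1.
  have xC w : w \in C -> adj x w by move=> /CP [].
  case/or3P => [/eqP ->|/eqP ->|ha]; case/or3P => [/eqP ->|/eqP ->|hb] ne;
    rewrite ?eqxx // in ne *.
  - exact: xC.
  - by rewrite adj_sym.
  - by rewrite adj_sym; apply: zC => //; rewrite eq_sym.
  - by rewrite adj_sym; exact: xC.
  - exact: zC.
  - by move/cliqueP: clC; apply.
have [K mK sK] := maxset_exists clK.
exists K; last first.
  by apply/andP; split; apply: (subsetP sK); rewrite !in_setU1 eqxx ?orbT.
rewrite /grand_clique mK /=.
have : #|x |: C| <= #|K|.
  apply: subset_leq_card; apply: subset_trans sK; apply: setUS; exact: subsetUr.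
rewrite cardsU1 !inE adj_irrefl /= => h.
by apply: leq_trans (leq_add h (leqnn _)); rewrite addn2 -addnA add1n ltnS.
Qed.

Hypothesis lambda_large : 2 * ((s - 1) * M) + M < lambda.+1.

(** Two distinct maximal cliques contain non-adjacent vertices p and q, so their
    intersection consists of common neighbours of p and q, whereas their union
    consists, up to [x] and [z], of common neighbours of [x] and [z]. *)
Lemma grand_clique_unique (x z : G) (K K' : {set G}) : x != z ->
  grand_clique K -> grand_clique K' ->
  x \in K -> z \in K -> x \in K' -> z \in K' -> K = K'.
Proof.
move=> ne /andP [mK gK] /andP [mK' gK'] xK zK xK' zK'.
apply/eqP/negPn/negP => neK.
have /maxsetP [/cliqueP cK maxK] := mK; have /maxsetP [/cliqueP cK' maxK'] := mK'.
have [h|] := boolP (clique (K :|: K')).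
  move: neK; rewrite -{1}(maxK _ h (subsetUl _ _)) -{2}(maxK' _ h (subsetUr _ _)).
  by rewrite eqxx.
move=> nc.
have [p [q [pK qK' pq na]]] :
   exists p q, [/\ p \in K, q \in K', p != q & ~~ adj p q].
  move: nc => /forallPn [p]; rewrite negb_imply => /andP [hp] /forallPn [q].
  rewrite negb_imply => /andP [hq]; rewrite negb_imply => /andP [pq na].
  move: hp hq; rewrite !in_setU => /orP [hp|hp] /orP [hq|hq].
  - by move/negP: na; case; apply: cK.
  - by exists p, q.
  - by exists q, p; split => //; rewrite 1?eq_sym 1?adj_sym.
  - by move/negP: na; case; apply: cK'.
have hI : #|K :&: K'| <= M.+1.
  apply: leq_trans (cn_nadj pq na); apply: subset_leq_card.
  apply/subsetP => w; rewrite !inE => /andP [wK wK'].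
  have wp : w != p.
    by apply/eqP => e; rewrite e in wK'; move/negP: na; case; apply: cK'.
  have wq : w != q.
    by apply/eqP => e; rewrite e in wK; move/negP: na; case; apply: cK.
  by rewrite cK ?cK' // eq_sym.
have hU : #|K :|: K'| <= lambda.+2.
  have xz : adj x z by exact: cK.
  have <- : #|x |: (z |: common_neighbours x z)| = lambda.+2.
    by rewrite cardsU1 (card_closed_cn xz) !inE (negbTE ne) adj_irrefl.
  apply: subset_leq_card; apply/subsetP => w hw; rewrite !inE.
  case: (eqVneq w x) => //= wx; case: (eqVneq w z) => //= wz.
  rewrite eq_sym in wx; rewrite eq_sym in wz.
  by move: hw; rewrite in_setU => /orP [] hw; rewrite ?(cK _ _ xK hw) ?(cK _ _ zK hw)
    ?(cK' _ _ xK' hw) ?(cK' _ _ zK' hw).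
move: (cardsUI K K') hU hI gK gK' lambda_large; clear; lia.
Qed.

End GrandCliques.

(** * Two inequalities for positive semidefinite and low-rank matrices *)

Section LinearAlgebra.
Local Open Scope ring_scope.

(** By hypothesis [Q] is a Gram matrix up to the factor [c], so its third Hadamard power is
    positive semidefinite; this is the value of the form at the all-one vector. *)
Lemma sum_cube_ge0 (R : realDomainType) (I : finType) (Q : I -> I -> R) (c : R) :
  0 < c -> (forall i j, \sum_z Q i z * Q j z = c * Q i j) ->
  0 <= \sum_i \sum_j Q i j ^+ 3.
Proof.
move=> c0 hQ; rewrite -(pmulr_rge0 _ (exprn_gt0 3 c0)).
suff -> : c ^+ 3 * (\sum_i \sum_j Q i j ^+ 3) =
  \sum_z \sum_w \sum_u (\sum_i Q i z * Q i w * Q i u) ^+ 2.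
  by do 3!(apply: sumr_ge0 => ? _); exact: sqr_ge0.
transitivity (\sum_i \sum_j \sum_z \sum_w \sum_u
   (Q i z * Q i w * Q i u) * (Q j z * Q j w * Q j u)).
  rewrite mulr_sumr; apply: eq_bigr => i _; rewrite mulr_sumr; apply: eq_bigr => j _.
  transitivity ((\sum_z Q i z * Q j z) * ((\sum_z Q i z * Q j z) * (\sum_z Q i z * Q j z))).
    by rewrite hQ; ring.
  rewrite mulr_suml; apply: eq_bigr => z _.
  rewrite mulrA [X in X * _]mulr_sumr mulr_suml; apply: eq_bigr => w _.
  by rewrite mulr_sumr; apply: eq_bigr => u _; ring.
under eq_bigr => i _ do rewrite exchange_big.
rewrite exchange_big; apply: eq_bigr => z _ /=.
under eq_bigr => i _ do rewrite exchange_big.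
rewrite exchange_big; apply: eq_bigr => w _ /=.
under eq_bigr => i _ do rewrite exchange_big.
rewrite exchange_big; apply: eq_bigr => u _ /=.
by rewrite expr2 mulr_suml; apply: eq_bigr => i _; rewrite mulr_sumr.
Qed.

Lemma trace_scaled_idem (F : fieldType) (n : nat) (P : 'M[F]_n) (c : F) :
  c != 0 -> P *m P = c *: P -> \tr P = c * (\rank P)%:R.
Proof.
move=> c0 hP.
move: (row_base_free P) (col_base_full P) (mulmx_base P).
move: (\rank P) (row_base P) (col_base P) => r B C.
move=> /row_freeP [B' hB] /row_fullP [C' hC] eP.
have e : B *m C = c%:M.
  have : C' *m (P *m P) *m B' = C' *m (c *: P) *m B' by rewrite hP.
  rewrite -!eP -scalemxAr -scalemxAl.
  rewrite !mulmxA hC mul1mx -!mulmxA hB mulmx1 => ->.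
  by rewrite scalemx1.
by rewrite -eP mxtrace_mulC e mxtrace_scalar mulr_natr.
Qed.

(** The number of quadratic monomials in [n] variables. *)
Lemma card_pairs (n : nat) :
  (2 * #|[set p : 'I_n * 'I_n | (p.1 <= p.2)%N]| = n * n.+1)%N.
Proof.
have e : #|[set p : 'I_n * 'I_n | (p.1 <= p.2)%N]| =
    (\sum_(i < n) \sum_(j < n) (i <= j)%N)%N.
  rewrite -sum1_card pair_big /= big_mkcond /=; apply: eq_bigr => p _.
  by rewrite inE; case: (p.1 <= p.2)%N.
rewrite mul2n -addnn {1}e e [X in (_ + X)%N]exchange_big -big_split /=.
transitivity (\sum_(i < n) n.+1)%N; last by rewrite sum_nat_const card_ord.
apply: eq_bigr => i _; rewrite -big_split /=.
transitivity (\sum_(j < n) (1 + (j == i)))%N.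
  by apply: eq_bigr => j _; rewrite -val_eqE /=; case: ltngtP.
rewrite big_split /= sum_nat_const card_ord muln1 (bigD1 i) //= eqxx big1 ?addn0 ?addn1 //.
by move=> j /negbTE ->.
Qed.

(** If the Hadamard product of two matrices with columns in the same [n]-dimensional space
    is a nonzero scalar matrix, its size is at most the number of quadratic monomials in
    [n] variables. *)
Lemma hadamard_rank (F : fieldType) (v n : nat) (X : 'M[F]_(v, n)) (Y Y' : 'M[F]_(n, v))
    (kappa : F) : kappa != 0 ->
  (forall x y, (X *m Y) x y * (X *m Y') x y = kappa * (x == y)%:R) ->
  (2 * v <= n * n.+1)%N.
Proof.
move=> k0 h; rewrite -card_pairs leq_mul2l /=.
set T := [set p : 'I_n * 'I_n | (p.1 <= p.2)%N].
pose Z : 'M[F]_(v, #|T|) := \matrix_(x, p) (X x (enum_val p).1 * X x (enum_val p).2).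
(* Up to symmetry, the coefficient of the monomial p in the product of two linear forms. *)
pose w (p : 'I_n * 'I_n) y : F := if p.1 == p.2 then Y p.1 y * Y' p.1 y else
  Y p.1 y * Y' p.2 y + Y p.2 y * Y' p.1 y.
pose W : 'M[F]_(#|T|, v) := \matrix_(p, y) w (enum_val p) y.
have e : Z *m W = kappa%:M.
  apply/matrixP => x y; rewrite mxE.
  transitivity (\sum_(p in T) X x p.1 * X x p.2 * w p y).
    by rewrite [RHS]big_enum_val; apply: eq_bigr => p _; rewrite !mxE.
  rewrite !mxE -[RHS]mulr_natr -h !mxE.
  rewrite mulr_suml.
  under [RHS]eq_bigr => i _ do rewrite mulr_sumr.
  rewrite pair_big /=.
  pose f (p : 'I_n * 'I_n) := X x p.1 * Y p.1 y * (X x p.2 * Y' p.2 y).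
  rewrite [RHS](bigID (mem T)) /= -/(f _).
  have -> : \sum_(p | p \notin T) X x p.1 * Y p.1 y * (X x p.2 * Y' p.2 y) =
            \sum_(p in T | p.1 != p.2) f (p.2, p.1).
    rewrite (reindex_inj (h := fun p : 'I_n * 'I_n => (p.2, p.1))) /=; last first.
      by move=> [a b] [a' b'] [-> ->].
    apply: eq_bigl => -[a b]; rewrite !inE /= -ltnNge ltn_neqAle andbC.
    by rewrite -val_eqE.
  rewrite big_mkcondr /= -big_split /=; apply: eq_bigr => -[a b] _; rewrite /w /f /=.
  case: (eqVneq a b) => [->|_] /=; ring.
rewrite -(mxrank1 F v).
have -> : 1%:M = (kappa^-1 *: Z) *m W.
  by rewrite -scalemxAl e scale_scalar_mx mulVf.
by rewrite (leq_trans (mxrankM_maxl _ _)) // rank_leq_col.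
Qed.

End LinearAlgebra.

(** * Partial geometries with alpha < t have bounded lines *)

Section PartialGeometryBound.
Local Open Scope ring_scope.
Variables (S : incidence_structure) (s t a : nat).
Hypothesis pgS : partial_geometry S s t a.
Hypothesis a_lt_t : (a < t)%N.

Let pg_s_gt0 : (0 < s)%N. Proof. by case: pgS => -[]. Qed.
Let pg_t_gt0 : (0 < t)%N. Proof. by case: pgS => -[]. Qed.
Let pg_a_gt0 : (0 < a)%N. Proof. by case: pgS => -[]. Qed.
Let pls : partial_linear_space S. Proof. by case: pgS. Qed.
Let lsize (l : line S) : #|[set x | inc x l]| = (s + 1)%N. Proof. by case: pgS. Qed.
Let pdeg (x : point S) : #|[set l | inc x l]| = (t + 1)%N. Proof. by case: pgS. Qed.
Let alphaE (l : line S) (x : point S) : ~~ inc x l ->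
  #|[set l' | inc x l' & meets l' l]| = a.
Proof. by case: pgS => _ _ _ _; apply. Qed.

Let tR : rat := t%:R.
Let sR : rat := s%:R.
Let aR : rat := a%:R.
(* The entry of [lproj] at two disjoint lines. *)
Let ep : rat := aR / (tR * (tR + 1 - aR)).

Let tR_gt0 : 0 < tR. Proof. by rewrite ltr0n. Qed.
Let sR_gt0 : 0 < sR. Proof. by rewrite ltr0n. Qed.
Let aR_gt0 : 0 < aR. Proof. by rewrite ltr0n. Qed.
Let aR_lt : aR + 1 <= tR. Proof. by rewrite /aR /tR natr1 ler_nat. Qed.

Let gap_gt0 : 0 < tR + 1 - aR.
Proof. by have := aR_lt; have := aR_gt0; lra. Qed.

Ltac pg_lra := move: aR_gt0 tR_gt0 sR_gt0 aR_lt; lra.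
Ltac pg_nra := move: aR_gt0 tR_gt0 sR_gt0 aR_lt; nra.

(** The adjacency matrix of the line graph, whose vertices are the lines, two of them
    adjacent when they meet, and the identity matrix. *)
Definition lmeet (l l' : line S) : rat := ((l != l') && meets l l')%:R.
Definition lid (l l' : line S) : rat := (l == l')%:R.
(** The orthogonal projection onto the functions on the lines that sum to 0 on every
    pencil, that is onto the kernel of the incidence matrix, scaled to have diagonal 1. *)
Definition lproj (l l' : line S) : rat :=
  lid l l' - tR^-1 * lmeet l l' + ep * (1 - lid l l' - lmeet l l').

Lemma meets_sym (l l' : line S) : meets l l' = meets l' l.
Proof. by apply: eq_existsb => x; rewrite andbC. Qed.

Lemma lproj_sym l l' : lproj l l' = lproj l' l.
Proof. by rewrite /lproj /lid /lmeet eq_sym meets_sym. Qed.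

Lemma lprojxx l : lproj l l = 1.
Proof. by rewrite /lproj /lid /lmeet eqxx /=; ring. Qed.

Lemma sum_lproj_point (x : point S) l' : \sum_(l | inc x l) lproj l l' = 0.
Proof.
have [hx|nx] := boolP (inc x l').
  rewrite (bigD1 l') //= lprojxx (eq_bigr (fun=> - tR^-1)); last first.
    move=> l /andP [hl ne]; rewrite /lproj /lid /lmeet (negbTE ne) /=.
    have -> : meets l l' by apply/existsP; exists x; rewrite hl hx.
    by rewrite /=; ring.
  rewrite sumr_const; have := pdeg x; rewrite (cardsD1 l') inE hx addnC => /eqP.
  rewrite eqn_add2r => /eqP e.
  rewrite (_ : #|_| = t); last first.
    by rewrite -e; apply: eq_card => l; rewrite !inE andbC.
  by rewrite mulNrn -mulr_natr mulVf ?subrr // gt_eqF.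
rewrite (bigID (fun l => meets l l')) /=.
rewrite (eq_bigr (fun=> - tR^-1)); last first.
  move=> l /andP [hl hm]; rewrite /lproj /lid /lmeet hm.
  have -> : (l == l') = false by apply/eqP => e; rewrite -e hl in nx.
  by rewrite /=; ring.
rewrite [X in _ + X](eq_bigr (fun=> ep)); last first.
  move=> l /andP [hl hm]; rewrite /lproj /lid /lmeet (negbTE hm) andbF.
  have -> : (l == l') = false by apply/eqP => e; rewrite -e hl in nx.
  by rewrite /=; ring.
rewrite !sumr_const.
have e1 : #|[pred l | inc x l & meets l l']| = a.
  by rewrite -(alphaE nx); apply: eq_card => l; rewrite !inE.
have e2 : (#|[pred l | inc x l & ~~ meets l l']| + a = t + 1)%N.
  rewrite -e1 -(pdeg x) -(cardID [pred l | meets l l'] [set l | inc x l]) addnC.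
  by congr (_ + _)%N; apply: eq_card => l; rewrite !inE // andbC.
have -> : #|(fun l : line S => inc x l && meets l l')| = a by rewrite -e1; apply: eq_card.
have -> : #|(fun l : line S => inc x l && ~~ meets l l')| = (t + 1 - a)%N.
  by rewrite -e2 addnK; apply: eq_card.
rewrite mulNrn -[tR^-1 *+ a]mulr_natr -[ep *+ _]mulr_natr natrB; last by rewrite (leq_trans (ltnW a_lt_t)) ?leq_addr.
have h : tR + 1 - aR != 0 by rewrite gt_eqF ?gap_gt0.
by rewrite natrD /ep -/tR -/aR; field; rewrite h gt_eqF.
Qed.

Lemma sum_lproj l' : \sum_l lproj l l' = 0.
Proof.
have : \sum_x \sum_(l | inc x l) lproj l l' = 0.
  by apply: big1 => x _; exact: sum_lproj_point.
rewrite (exchange_big_dep predT) //=.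
rewrite (eq_bigr (fun l => (s + 1)%:R * lproj l l')); last first.
  move=> l _; rewrite sumr_const mulr_natl; congr (_ *+ _).
  by rewrite -(lsize l); apply: eq_card => x; rewrite inE.
by rewrite -mulr_sumr => /eqP; rewrite mulf_eq0 pnatr_eq0 addn1 => /eqP.
Qed.

Let e : rat := tR^-1 + ep.
Let c : rat := e * (sR + 1 + tR - aR).

Lemma eE : e = (tR + 1) / (tR * (tR + 1 - aR)).
Proof.
have h : tR + 1 - aR != 0 by rewrite gt_eqF ?gap_gt0.
by rewrite /e /ep; field; rewrite h gt_eqF.
Qed.

Lemma ep_gt0 : 0 < ep.
Proof. by rewrite /ep divr_gt0 // mulr_gt0 //; pg_lra. Qed.

Lemma e_gt0 : 0 < e.
Proof. by rewrite /e addr_gt0 ?invr_gt0 ?ep_gt0. Qed.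

Lemma one_sub_ep : 1 - ep = e * (tR - aR).
Proof.
have h : tR + 1 - aR != 0 by rewrite gt_eqF ?gap_gt0.
by rewrite eE /ep; field; rewrite h gt_eqF.
Qed.

Lemma c_gt0 : 0 < c.
Proof. by rewrite /c mulr_gt0 ?e_gt0 //; pg_lra. Qed.

Lemma lprojE l l' : lproj l l' = e * ((tR - aR) * lid l l' - lmeet l l') + ep.
Proof. by rewrite mulrBr mulrA -one_sub_ep /lproj /e; ring. Qed.

Lemma card_meet_points l l' :
  #|[set x | inc x l & inc x l']|%:R = lmeet l l' + (sR + 1) * lid l l'.
Proof.
rewrite /lmeet /lid; have [<-|ne] := eqVneq l l'.
  rewrite /= add0r mulr1 [RHS]natr1 -addn1 -(lsize l); congr (_%:R).
  by apply: eq_card => x; rewrite !inE andbb.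
rewrite mulr0 addr0 /=; congr (_%:R).
have [/existsP [x /andP [h1 h2]]|h] := boolP (meets l l'); last first.
  apply/eqP; rewrite cards_eq0; apply/eqP/setP => x; rewrite !inE.
  by move: h; rewrite negb_exists => /forallP /(_ x) /negbTE.
rewrite -[RHS](cards1 x); apply: eq_card => y; rewrite !inE.
apply/idP/eqP => [/andP [h3 h4]|->]; last by rewrite h1 h2.
apply/eqP/negPn/negP => nxy; move/eqP: ne; apply.
exact: (pls nxy h3 h1 h4 h2).
Qed.

(** [lproj] squares to [c] times itself: write it as a combination of the identity, N^T N and
    the all-one matrix, and use that its pencil sums vanish. *)
Lemma lproj_sqr l l' : \sum_z lproj l z * lproj l' z = c * lproj l l'.
Proof.
have hE z : lproj l z = c * lid l z - e * #|[set x | inc x l & inc x z]|%:R + ep.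
  by rewrite lprojE card_meet_points /c; ring.
transitivity (\sum_z (lid l z * (c * lproj l' z) + ep * lproj z l'
   - e * (#|[set x | inc x l & inc x z]|%:R * lproj z l'))).
  apply: eq_bigr => z _; rewrite hE (lproj_sym l' z); ring.
rewrite sumrB big_split /= -!mulr_sumr sum_lproj mulr0 addr0.
have -> : \sum_z #|[set x | inc x l & inc x z]|%:R * lproj z l' = 0.
  transitivity (\sum_z \sum_(x | inc x l && inc x z) lproj z l').
    apply: eq_bigr => z _; rewrite sumr_const mulr_natl; congr (_ *+ _).
    by apply: eq_card => x; rewrite inE.
  rewrite (exchange_big_dep (fun x => inc x l)) /=; last by move=> ? ? _ /andP [].
  apply: big1 => x hx; rewrite -[RHS](sum_lproj_point x l').
  by apply: eq_bigl => z; rewrite hx.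
rewrite mulr0 subr0 (bigD1 l) //= big1 ?addr0; last first.
  by move=> z; rewrite /lid eq_sym => /negbTE ->; rewrite mul0r.
by rewrite /lid eqxx mul1r lproj_sym.
Qed.

Lemma sum_lid l : \sum_z lid l z = 1.
Proof.
rewrite (bigD1 l) //= /lid eqxx big1 ?addr0 // => z.
by rewrite eq_sym => /negbTE ->.
Qed.

Lemma sum_lmeet l : \sum_z lmeet l z = (sR + 1) * tR.
Proof.
have -> : \sum_z lmeet l z = \sum_z #|[set x | inc x l & inc x z]|%:R
    - (sR + 1) * \sum_z lid l z.
  rewrite mulr_sumr -sumrB; apply: eq_bigr => z _; rewrite card_meet_points; ring.
rewrite sum_lid.
have -> : \sum_z #|[set x | inc x l & inc x z]|%:R = (sR + 1) * (tR + 1).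
  transitivity (\sum_z \sum_(x | inc x l && inc x z) (1 : rat)).
    apply: eq_bigr => z _; rewrite sumr_const; congr (_%:R).
    by apply: eq_card => x; rewrite inE.
  rewrite (exchange_big_dep (fun x => inc x l)) /=; last by move=> ? ? _ /andP [].
  rewrite (eq_bigr (fun=> (t + 1)%:R)); last first.
    move=> x hx; rewrite sumr_const; congr (_%:R).
    by rewrite -(pdeg x); apply: eq_card => z; rewrite !inE unfold_in /= hx.
  rewrite sumr_const -[_ *+ #|_|]mulr_natl [tR + 1]natr1 [sR + 1]natr1 -(addn1 s) -(addn1 t) -(lsize l).
  congr (_%:R * _).
  by apply: eq_card => x; rewrite inE.
ring.
Qed.

Let b : rat := #|line S|%:R.

(** The number of lines, read off from the row sums of [lproj]. *)
Lemma b_eq : aR * b = (tR + 1) * (sR * tR + aR).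
Proof.
have [l _] : exists l, l \in line S.
  by apply/card_gt0P; exact: line_nonempty.
have := sum_lproj l.
under eq_bigr => z _ do rewrite lproj_sym.
have -> : \sum_z lproj l z = \sum_z lid l z - (tR^-1 + ep) * \sum_z lmeet l z
   + ep * (\sum_(z : line S) 1 - \sum_z lid l z).
  rewrite -sumrB !mulr_sumr -sumrB -big_split /=; apply: eq_bigr => z _.
  rewrite /lproj; ring.
rewrite sum_lid sum_lmeet -/e eE sumr_const -/b /ep => h.
have h1 : tR + 1 - aR != 0 by rewrite gt_eqF ?gap_gt0.
have : tR * (tR + 1 - aR) * (1 - (tR + 1) / (tR * (tR + 1 - aR)) * ((sR + 1) * tR) +
     aR / (tR * (tR + 1 - aR)) * (b - 1)) = 0 by rewrite h mulr0.
have -> : tR * (tR + 1 - aR) * (1 - (tR + 1) / (tR * (tR + 1 - aR)) * ((sR + 1) * tR) +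
     aR / (tR * (tR + 1 - aR)) * (b - 1)) =
   tR * (tR + 1 - aR) - (tR + 1) * ((sR + 1) * tR) + aR * (b - 1).
  by field; rewrite h1 gt_eqF.
move=> h2; pg_lra.
Qed.

(** The Krein condition for the eigenvalue -(s + 1) of the line graph. *)
Lemma krein_pg : sR * (tR + 1 - 2%:R * aR) <= (tR - 1) * (tR + 1 - aR) ^+ 2.
Proof.
have := sum_cube_ge0 c_gt0 lproj_sqr.
have hrow l : \sum_z lproj l z ^+ 3 =
  1 - tR^-1 ^+ 3 * ((sR + 1) * tR) + ep ^+ 3 * (b - 1 - (sR + 1) * tR).
  have -> : \sum_z lproj l z ^+ 3 = \sum_z lid l z - tR^-1 ^+ 3 * \sum_z lmeet l z
   + ep ^+ 3 * (\sum_(z : line S) 1 - \sum_z lid l z - \sum_z lmeet l z).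
    rewrite -!sumrB !mulr_sumr -sumrB -big_split /=; apply: eq_bigr => z _.
    rewrite /lproj /lid /lmeet; have [e1|ne] := eqVneq l z => /=; first by ring.
    by case: (meets l z) => /=; ring.
  by rewrite sum_lid sum_lmeet sumr_const.
under eq_bigr => l _ do rewrite hrow.
rewrite sumr_const -[_ *+ #|_|]mulr_natl pmulr_rge0; last by rewrite ltr0n line_nonempty.
have h1 : 0 < tR + 1 - aR by pg_lra.
have -> : b = (tR + 1) * (sR * tR + aR) / aR.
  by rewrite -b_eq mulrAC mulfV ?mul1r // gt_eqF.
rewrite /ep => h.
have := mulr_ge0 (mulr_ge0 (ltW tR_gt0) (ltW tR_gt0)) (mulr_ge0 (sqr_ge0 (tR + 1 - aR)) h).
have -> : tR * tR * ((tR + 1 - aR) ^+ 2 * (1 - tR^-1 ^+ 3 * ((sR + 1) * tR) +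
   (aR / (tR * (tR + 1 - aR))) ^+ 3 *
   ((tR + 1) * (sR * tR + aR) / aR - 1 - (sR + 1) * tR))) =
   (tR + 1) * ((tR - 1) * (tR + 1 - aR) ^+ 2 - sR * (tR + 1 - 2%:R * aR)).
  by field; rewrite !gt_eqF.
by rewrite pmulr_rge0 ?subr_ge0 //; pg_lra.
Qed.

Local Notation n := #|line S|.
Let Qm : 'M[rat]_n := \matrix_(i, j) lproj (enum_val i) (enum_val j).
Let Bm : 'M[rat]_n := \matrix_(i, j)
  ((tR - aR) * lid (enum_val i) (enum_val j) - lmeet (enum_val i) (enum_val j)).

Lemma sum_enum_val (F : line S -> rat) : \sum_(i < n) F (enum_val i) = \sum_l F l.
Proof. by rewrite [RHS](big_enum_val F). Qed.

(** The rank of [Qm] is the multiplicity of the eigenvalue -(s + 1) of the line graph. *)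
Lemma rank_Qm : c * (\rank Qm)%:R = b.
Proof.
rewrite -(trace_scaled_idem (c := c)); last 1 first.
- apply/matrixP => i j; rewrite !mxE -lproj_sqr.
  rewrite -(sum_enum_val (fun z => lproj (enum_val i) z * lproj (enum_val j) z)).
  by apply: eq_bigr => z _; rewrite !mxE (lproj_sym (enum_val z)).
- rewrite /mxtrace (eq_bigr (fun=> 1)); last by move=> i _; rewrite mxE lprojxx.
  by rewrite sumr_const card_ord.
- by rewrite gt_eqF // c_gt0.
Qed.

Lemma rank_Bm : (\rank Bm <= (\rank Qm).+1)%N.
Proof.
have -> : Bm = e^-1 *: Qm + (- ep / e) *: ((const_mx 1 : 'cV_n) *m (const_mx 1 : 'rV_n)).
  apply/matrixP => i j; rewrite !mxE big_ord1 !mxE lprojE.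
  by field; rewrite gt_eqF // e_gt0.
apply: leq_trans (mxrank_add _ _) _; rewrite -[(\rank Qm).+1]addn1; apply: leq_add.
  exact: mxrank_scale.
apply: leq_trans (mxrank_scale _ _) _.
exact: leq_trans (mxrankM_maxl _ _) (rank_leq_col _).
Qed.

(** An absolute bound. The entries of [Bm] off the diagonal are 0 and -1, so the Hadamard
    product of [Bm] and Bm + J, with J the all-one matrix, is a multiple of the identity; the
    multiple is not 0 because a < t. Since [Bm] has constant row sums, J has its columns in
    the column space of [Bm]. *)
Lemma absolute_pg : (2 * #|line S| <= (\rank Qm).+1 * (\rank Qm).+2)%N.
Proof.
suff : (2 * n <= \rank Bm * (\rank Bm).+1)%N.
  by move=> h; apply: (leq_trans h); have := rank_Bm; nia.
have rs : (tR - aR) - (sR + 1) * tR != 0 by rewrite lt_eqF //; pg_nra.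
pose u : 'cV[rat]_n := const_mx ((tR - aR) - (sR + 1) * tR)^-1.
have hu : Bm *m u = const_mx 1.
  apply/matrixP => i j; rewrite !mxE.
  rewrite (eq_bigr (fun k => Bm i k * ((tR - aR) - (sR + 1) * tR)^-1)); last first.
    by move=> k _; rewrite !mxE.
  rewrite -mulr_suml; apply: (mulfI rs); rewrite mulrCA mulfV // mulr1 mulr1.
  rewrite -(sum_lmeet (enum_val i)).
  under eq_bigr => k _ do rewrite mxE.
  rewrite (sum_enum_val (fun z => (tR - aR) * lid (enum_val i) z - lmeet (enum_val i) z)).
  by rewrite sumrB -mulr_sumr sum_lid mulr1.
pose Y' := row_base Bm + row_base Bm *m u *m const_mx 1.
have hY : col_base Bm *m row_base Bm = Bm by exact: mulmx_base.
have hY' : col_base Bm *m Y' = Bm + const_mx 1.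
  rewrite mulmxDr hY 2!mulmxA hY hu; congr (_ + _).
  by apply/matrixP => i j; rewrite !mxE big_ord1 !mxE mulr1.
have k0 : (tR - aR) * (tR - aR + 1) != 0.
  by rewrite gt_eqF // mulr_gt0 //; pg_lra.
apply: (hadamard_rank (X := col_base Bm) (Y := row_base Bm) (Y' := Y') k0) => i j.
rewrite hY hY' !mxE.
rewrite -(inj_eq enum_val_inj) /lid /lmeet.
by case: eqP => //= _; case: (meets (enum_val i) (enum_val j)) => /=; ring.
Qed.

(** The Krein condition bounds [s] when [a] is small relative to [t], and the absolute bound
    does otherwise. *)
Lemma pg_bound : (3 * s < 8 * t ^ 2 * a)%N.
Proof.
rewrite ltnNge; apply/negP => big.
have bigR : 8%:R * tR ^+ 2 * aR <= 3%:R * sR.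
  by rewrite -natrX -!natrM ler_nat.
have a1 : 1 <= aR by rewrite ler1n.
have [small|large] := leP (3%:R * aR) (tR + 1).
  have kr := krein_pg.
  set w := tR + 1 - aR in kr.
  have h1 : w <= 2%:R * (tR + 1 - 2%:R * aR) by rewrite /w; pg_lra.
  have h2 : sR * w <= 2%:R * (tR - 1) * w ^+ 2.
    apply: le_trans (_ : sR * (2%:R * (tR + 1 - 2%:R * aR)) <= _).
      by rewrite ler_wpM2l // ltW.
    pg_lra.
  have w0 : 0 < w by rewrite /w; pg_lra.
  have h3 : sR <= 2%:R * (tR - 1) * w.
    by move: h2; rewrite expr2 mulrA ler_pM2r.
  have h4 : sR <= 2%:R * (tR - 1) * tR.
    by apply: le_trans h3 _; rewrite ler_wpM2l // /w; pg_lra.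
  pg_nra.
pose r := \rank Qm.
have rE := rank_Qm; rewrite -/r in rE.
have bE := b_eq.
have ab := absolute_pg; rewrite -/r in ab.
have w0 : 0 < tR + 1 - aR by pg_lra.
have e1 : (tR + 1) * (sR + 1 + tR - aR) * (aR * r%:R) =
     tR * (tR + 1 - aR) * ((tR + 1) * (sR * tR + aR)).
  rewrite -bE -rE /c eE; by field; rewrite !gt_eqF.
have e2 : (sR + 1 + tR - aR) * (aR * r%:R) = tR * (tR + 1 - aR) * (sR * tR + aR).
  have t1 : tR + 1 != 0 by rewrite gt_eqF //; pg_lra.
  by apply: (mulfI t1); transitivity ((tR + 1) * (sR + 1 + tR - aR) * (aR * r%:R)); [ring | rewrite e1; ring].
have e3 : aR * r%:R <= tR ^+ 2 * (tR + 1 - aR).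
  have p : 0 < sR + 1 + tR - aR by pg_lra.
  rewrite -(ler_pM2l p) e2.
  have -> : (sR + 1 + tR - aR) * (tR ^+ 2 * (tR + 1 - aR)) =
     tR * (tR + 1 - aR) * (tR * (sR + (tR + 1 - aR))) by ring.
  rewrite ler_pM2l ?mulr_gt0 //; pg_nra.
have e4 : (r < 2 * t ^ 2)%N.
  rewrite -(ltr_nat rat) natrM natrX -/tR -(ltr_pM2l aR_gt0).
  apply: le_lt_trans e3 _; rewrite mulrA mulrC ltr_pM2r ?exprn_gt0 //; pg_lra.
have : (2 * #|line S| <= (2 * t ^ 2) * (2 * t ^ 2).+1)%N.
  apply: leq_trans ab _; apply: leq_mul => //.
rewrite -(ler_nat rat) -addn1 !(natrM, natrD, natrX) -/tR -/b => h.
have h2 := ler_wpM2l (ltW aR_gt0) h.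
move: h2; rewrite (_ : aR * (2%:R * b) = 2%:R * (aR * b)); last by ring.
rewrite bE => h2.
have h3 : 16%:R * tR ^+ 3 * (tR + 1) * aR <= 3%:R * (2%:R * ((tR + 1) * (sR * tR + aR))).
  have : (tR + 1) * tR * (8%:R * tR ^+ 2 * aR) <= (tR + 1) * tR * (3%:R * sR).
    by rewrite ler_pM2l // mulr_gt0 //; pg_lra.
  pg_nra.
have h4 : 16%:R * tR ^+ 3 * (tR + 1) <= 3%:R * (2%:R * tR ^+ 2 * (2%:R * tR ^+ 2 + 1)).
  rewrite -(ler_pM2l aR_gt0).
  have := le_trans h3 (ler_wpM2l (ler0n _ 3) h2); pg_lra.
have t2 : 2%:R <= tR by pg_lra.
have h5 : 16%:R * tR * (tR + 1) <= 6%:R * (2%:R * tR ^+ 2 + 1).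
  have t0 : 0 < tR ^+ 2 by rewrite exprn_gt0.
  rewrite -(ler_pM2l t0); pg_lra.
pg_nra.
Qed.

End PartialGeometryBound.

(** * Partial geometries with alpha = t: Latin square graphs *)

Lemma isomorphic_trans (G H K : sgraph) :
  isomorphic G H -> isomorphic H K -> isomorphic G K.
Proof.
move=> [f [bf hf]] [h [bh hh]]; exists (h \o f); split; first exact: bij_comp.
by move=> x y /=; rewrite hh hf.
Qed.

Section Nets.
Variables (S : incidence_structure) (s t : nat).
Hypothesis pgS : partial_geometry S s t t.

(** Two lines are parallel when they are equal or disjoint. *)
Definition parallel (l l' : line S) : bool := (l == l') || ~~ meets l l'.

Let pls : partial_linear_space S. Proof. by case: pgS. Qed.

Lemma meetsI (x : point S) (l l' : line S) : inc x l -> inc x l' -> meets l l'.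
Proof. by move=> h h'; apply/existsP; exists x; rewrite h h'. Qed.

Lemma parallel_sym l l' : parallel l l' = parallel l' l.
Proof. by rewrite /parallel eq_sym meets_sym. Qed.

(** Euclid's axiom: of the t + 1 lines on a point off [l], all but one meet [l]. *)
Lemma card_parallel_through (x : point S) (l : line S) :
  #|[set l' | inc x l' & parallel l' l]| = 1.
Proof.
have [hx|nx] := boolP (inc x l).
  rewrite -(cards1 l); apply: eq_card => l'; rewrite !inE /parallel.
  have [->|ne] := eqVneq l' l; first by rewrite hx.
  by have [h|//] := boolP (inc x l'); rewrite (meetsI h hx).
have [_ _ _ deg al] := pgS.
have := al _ _ nx; have := deg x.
rewrite -(cardsID [set l' | meets l' l] [set l' | inc x l']).
have -> : [set l' | inc x l'] :&: [set l' | meets l' l] =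
  [set l' | inc x l' & meets l' l] by apply/setP => l'; rewrite !inE.
have -> : [set l' | inc x l'] :\: [set l' | meets l' l] =
  [set l' | inc x l' & parallel l' l].
  apply/setP => l'; rewrite !inE andbC /parallel.
  by case: (eqVneq l' l) => [->|//]; rewrite (negbTE nx).
by move=> + e; rewrite e => /eqP; rewrite eqn_add2l => /eqP.
Qed.

(** The line through [x] parallel to [l]. *)
Definition parallel_through (x : point S) (l : line S) : line S :=
  odflt l [pick l' | inc x l' && parallel l' l].

Lemma parallel_throughP x l :
  inc x (parallel_through x l) && parallel (parallel_through x l) l.
Proof.
rewrite /parallel_through; case: pickP => //= h.
have := card_parallel_through x l; rewrite eq_card0 // => l'.
by rewrite !inE h.
Qed.

Lemma parallel_through_uniq x l l' :
  inc x l' -> parallel l' l -> l' = parallel_through x l.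
Proof.
move=> h p; have /eqP/cards1P [l0 e] := card_parallel_through x l.
have /andP [h1 p1] := parallel_throughP x l.
have /set1P -> : l' \in [set l0] by rewrite -e inE h p.
by apply/esym/set1P; rewrite -e inE h1 p1.
Qed.

Lemma parallel_trans l l' l'' : parallel l l' -> parallel l' l'' -> parallel l l''.
Proof.
move=> p p'; rewrite /parallel; have [//|ne] := eqVneq l l''.
apply/negP => /existsP [x /andP [h h'']]; move/eqP: ne; apply.
rewrite (parallel_through_uniq h p); apply/esym; apply: parallel_through_uniq => //.
by rewrite parallel_sym.
Qed.

Lemma parallel_meet l l' x : parallel l l' -> inc x l -> inc x l' -> l = l'.
Proof. by move=> /orP [/eqP //|/negP n] h h'; case: n; exact: meetsI h h'. Qed.

(** The parallel class of [l]. *)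
Definition par_class (l : line S) : {set line S} := [set l' | parallel l' l].

(** The lines of a parallel class correspond to the points of a transversal line. *)
Lemma card_par_class l l1 : ~~ parallel l l1 -> #|par_class l| = s + 1.
Proof.
move=> np; have [_ _ lsize _ _] := pgS.
rewrite -(lsize l1).
have -> : par_class l = (fun x => parallel_through x l) @: [set x | inc x l1].
  apply/setP => l'; apply/idP/imsetP => [|[x _ ->]]; last first.
    by rewrite inE; case/andP: (parallel_throughP x l).
  rewrite inE => p.
  have : meets l' l1.
    rewrite -[meets _ _]negbK; apply/negP => nm; move/negP: np; apply.
    apply: (@parallel_trans _ l'); first by rewrite parallel_sym.
    by rewrite /parallel nm orbT.
  case/existsP => x /andP [h h1]; exists x; first by rewrite inE.
  exact: parallel_through_uniq.
rewrite card_in_imset // => x y; rewrite !inE => hx hy e.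
apply/eqP/negPn/negP => ne; move/negP: np; apply.
have /andP [x1 p1] := parallel_throughP x l.
have /andP [y1 p2] := parallel_throughP y l; rewrite -e in y1.
by rewrite -(pls ne x1 y1 hx hy) parallel_sym.
Qed.

(** The lines of two parallel classes serve as coordinates of the points. *)
Lemma card_points_net l l1 : ~~ parallel l l1 -> #|point S| = (s + 1) ^ 2.
Proof.
move=> np; have np' : ~~ parallel l1 l by rewrite parallel_sym.
rewrite -cardsT expnS expn1 -{1}(card_par_class np) -(card_par_class np') -cardsX.
pose F x := (parallel_through x l, parallel_through x l1).
have -> : setX (par_class l) (par_class l1) = F @: [set: point S].
  apply/setP => -[l' l1']; apply/idP/imsetP => [|[x _ [-> ->]]]; last first.
    rewrite !inE /=.
    by case/andP: (parallel_throughP x l) => _ ->; case/andP: (parallel_throughP x l1).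
  rewrite !inE /= => /andP [p p1].
  have : meets l' l1'.
    rewrite -[meets _ _]negbK; apply/negP => nm; move/negP: np; apply.
    apply: (@parallel_trans _ l'); first by rewrite parallel_sym.
    by apply: (@parallel_trans _ l1') => //; rewrite /parallel nm orbT.
  case/existsP => x /andP [h h1]; exists x; first by rewrite inE.
  by congr (_, _); exact: parallel_through_uniq.
rewrite card_imset // => x y [e e1].
apply/eqP/negPn/negP => ne; move/negP: np; apply.
have /andP [x1 p1] := parallel_throughP x l.
have /andP [x2 p2] := parallel_throughP x l1.
have /andP [y1 _] := parallel_throughP y l; rewrite -e in y1.
have /andP [y2 _] := parallel_throughP y l1; rewrite -e1 in y2.
have q := pls ne x1 y1 x2 y2.
apply: (@parallel_trans _ (parallel_through x l)); first by rewrite parallel_sym.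
by rewrite q.
Qed.

(** The rows of the array are the parallel classes, represented by the lines on a fixed
    point, the columns are the points, and an entry numbers, within the class of the row,
    the line on the point. *)
Lemma net_latin_square_graph :
  is_latin_square_graph (collinearity_graph S) t.+1 s.+1.
Proof.
have [[s0 t0 _] _ lsize deg _] := pgS.
have [x0 _] : exists x, x \in point S by apply/card_gt0P; exact: point_nonempty.
have [l0 _] : exists l, l \in line S by apply/card_gt0P; exact: line_nonempty.
pose e := enum [set l | inc x0 l].
have se : size e = t.+1 by rewrite -cardE deg addn1.
pose dir (i : 'I_t.+1) := nth l0 e i.
have dir_inc i : inc x0 (dir i).
  have : dir i \in e by rewrite mem_nth // se.
  by rewrite mem_enum inE.
have dir_par i j : i != j -> ~~ parallel (dir i) (dir j).
  move=> ne; apply/negP => p; move/negP: ne; apply.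
  have := parallel_meet p (dir_inc i) (dir_inc j) => /eqP.
  by rewrite nth_uniq ?se ?enum_uniq.
have ex_ne (i : 'I_t.+1) : exists j, i != j.
  exists (if i == ord0 then ord_max else ord0).
  have [->|//] := eqVneq i ord0.
  by rewrite -val_eqE /=; case: (t) t0.
have cls i : #|par_class (dir i)| = s.+1.
  by have [j ne] := ex_ne i; rewrite (card_par_class (dir_par _ _ ne)) addn1.
have cP : #|point S| = s.+1 ^ 2.
  by have [j ne] := ex_ne ord0; rewrite (card_points_net (dir_par _ _ ne)) addn1.
pose lab i x : 'I_s.+1 :=
  inord (index (parallel_through x (dir i)) (enum (par_class (dir i)))).
have mem_cls i x : parallel_through x (dir i) \in enum (par_class (dir i)).
  by rewrite mem_enum inE; case/andP: (parallel_throughP x (dir i)).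
have idx_lt i x :
    index (parallel_through x (dir i)) (enum (par_class (dir i))) < s.+1.
  by rewrite -(cls i) cardE index_mem.
have lab_inj i x y : lab i x = lab i y ->
    parallel_through x (dir i) = parallel_through y (dir i).
  move/(congr1 val) => /=; rewrite !inordK //.
  by move/(congr1 (nth l0 (enum (par_class (dir i))))); rewrite !nth_index.
pose phi (c : 'I_(s.+1 ^ 2)) : point S := enum_val (cast_ord (esym cP) c).
pose psi (x : point S) : 'I_(s.+1 ^ 2) := cast_ord cP (enum_rank x).
have phiK : cancel phi psi.
  by move=> c; rewrite /phi /psi enum_valK cast_ordKV.
have psiK z : phi (psi z) = z.
  by rewrite /phi /psi cast_ordK enum_rankK.
pose A : 'M['I_s.+1]_(t.+1, s.+1 ^ 2) := (\matrix_(i, c) lab i (phi c))%R.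
exists A.
  move=> i j ne c d; rewrite !mxE => -[/lab_inj e1 /lab_inj e2].
  apply: (can_inj phiK); apply/eqP/negPn/negP => nxy.
  move: (phi c) (phi d) nxy e1 e2 => x y nxy e1 e2.
  move/negP: (dir_par _ _ ne); apply.
  have /andP [x1 p1] := parallel_throughP x (dir i).
  have /andP [x2 p2] := parallel_throughP x (dir j).
  have /andP [y1 _] := parallel_throughP y (dir i); rewrite -e1 in y1.
  have /andP [y2 _] := parallel_throughP y (dir j); rewrite -e2 in y2.
  have q := pls nxy x1 y1 x2 y2.
  apply: (@parallel_trans _ (parallel_through x (dir i))); first by rewrite parallel_sym.
  by rewrite q.
exists psi; split; first by exists phi.
move=> x y; rewrite /= /column_adj /collinear (can_eq psiK); congr (_ && _).
apply/existsP/existsP => [[i]|[l /andP [hx hy]]].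
  rewrite !mxE !psiK => /eqP /lab_inj q; exists (parallel_through x (dir i)).
  have /andP [-> _] := parallel_throughP x (dir i).
  by rewrite q; have /andP [-> _] := parallel_throughP y (dir i).
have /andP [h p] := parallel_throughP x0 l.
have hm : parallel_through x0 l \in e by rewrite mem_enum inE.
have lt : index (parallel_through x0 l) e < t.+1 by rewrite -se index_mem.
exists (Ordinal lt); rewrite !mxE !psiK /lab.
have de : dir (Ordinal lt) = parallel_through x0 l by rewrite /dir nth_index.
rewrite de.
have p' : parallel l (parallel_through x0 l) by rewrite parallel_sym.
by rewrite -(parallel_through_uniq hx p') -(parallel_through_uniq hy p').
Qed.

End Nets.

(** * Partial geometries with alpha = t + 1: block graphs of designs *)

Section DualDesign.
Variables (S : incidence_structure) (s t : nat).
Hypothesis pgS : partial_geometry S s t (t + 1).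

Lemma all_lines_meet (l l' : line S) : meets l l'.
Proof.
have [[s0 _ _] _ lsize deg al] := pgS.
have [x] : exists x, x \in [set x | inc x l].
  by apply/set0Pn; rewrite -card_gt0 lsize addn1.
rewrite inE => hx.
have [hx'|nx] := boolP (inc x l'); first exact: meetsI hx hx'.
have /eqP := al _ _ nx.
have sub : [set l1 | inc x l1 & meets l1 l'] \subset [set l1 | inc x l1].
  by apply/subsetP => l1; rewrite !inE => /andP [].
rewrite -(deg x) => /eqP e.
have /eqP E : [set l1 | inc x l1 & meets l1 l'] == [set l1 | inc x l1].
  by rewrite eqEcard sub e leqnn.
have : l \in [set l1 | inc x l1] by rewrite inE.
by rewrite -E inE => /andP [].
Qed.

Lemma card_common_points (l l' : line S) : l != l' ->
  #|[set x | inc x l & inc x l']| = 1.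
Proof.
move=> ne; have [_ pls _ _ _] := pgS.
have /existsP [x /andP [h h']] := all_lines_meet l l'.
rewrite -(cards1 x); apply: eq_card => y; rewrite !inE.
apply/andP/eqP => [[k k']|->] //.
apply/eqP/negPn/negP => nxy; move/negP: ne; apply; apply/eqP.
exact: pls nxy k h k' h'.
Qed.

Lemma card_lines : #|line S| = (s + 1) * t + 1.
Proof.
have [_ _ lsize deg _] := pgS.
have [l _] : exists l, l \in line S by apply/card_gt0P; exact: line_nonempty.
rewrite (cardD1 l) inE addnC; congr (_ + _).
rewrite -sum1_card.
transitivity (\sum_(l' | l' != l) \sum_(x | inc x l' && inc x l) 1).
  rewrite (eq_bigl (fun l' => l' != l)); last by move=> l'; rewrite !inE andbT.
  apply: eq_bigr => l' ne; rewrite sum1_card -(card_common_points ne).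
  by apply: eq_card => x; rewrite inE.
rewrite (exchange_big_dep (fun x => inc x l)) /=; last by move=> ? ? _ /andP [].
rewrite (eq_bigr (fun=> t)); last first.
  move=> x hx; rewrite sum1_card.
  have := deg x; rewrite (cardsD1 l) inE hx addnC => /eqP.
  rewrite eqn_add2r => /eqP <-; apply: eq_card => l'.
  by rewrite !inE unfold_in /= andbT.
rewrite sum_nat_const; congr (_ * _).
by rewrite -(lsize l); apply: eq_card => x; rewrite inE.
Qed.

(** The points of the design are the lines, and its blocks are the pencils of lines on a
    point. *)
Lemma dual_design_block_graph :
  is_design_block_graph (collinearity_graph S) 2 ((s + 1) * t + 1) t.+1 1.
Proof.
have [[s0 t0 _] pls lsize deg _] := pgS.
pose pencil (x : point S) := [set l | inc x l].
have pencil_inj : injective pencil.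
  move=> x y exy; apply/eqP/negPn/negP => ne.
  have : 1 < #|pencil x| by rewrite deg; lia.
  case/card_gt1P => l [l' [hl hl' nl]].
  have := hl; have := hl'; rewrite exy !inE in hl hl' * => ky' ky.
  have : l \in pencil x by rewrite exy inE.
  have : l' \in pencil x by rewrite exy inE.
  rewrite !inE => kx' kx.
  by move/eqP: nl; apply; exact: pls ne kx ky kx' ky'.
pose B := pencil @: [set: point S].
have hB x : pencil x \in B by apply: imset_f; rewrite inE.
exists (line S : finType), B; split.
  split.
  - by apply/andP; split; nia.
  - exact: card_lines.
  - by move=> b /imsetP [x _ ->]; rewrite deg addn1.
  - move=> X /eqP/cards2P [l [l' [ne ->]]].
    have /eqP/cards1P [x ex] := card_common_points ne.
    have incx : inc x l && inc x l'.
      by have := set11 x; rewrite -ex inE.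
    rewrite -(cards1 (pencil x)); apply: eq_card => b; rewrite !inE.
    rewrite subUset !sub1set; apply/idP/eqP => [/and3P [/imsetP [y _ ->]]|->].
      rewrite !inE => hl hl'; congr pencil.
      by apply/set1P; rewrite -ex inE hl hl'.
    by rewrite hB !inE.
pose f (x : collinearity_graph S) : block_graph B := exist (fun b => b \in B) (pencil x) (hB x).
have f_inj : injective f by move=> x y /(congr1 val) /= /pencil_inj.
exists f; split.
  apply: inj_card_bij => //.
  by rewrite /= card_sig (eq_card (B := mem B)) // card_imset // cardsT.
move=> x y; rewrite /= /block_adj /collinear (inj_eq f_inj); congr (_ && _).
apply/set0Pn/existsP => [[l]|[l h]].
  by rewrite !inE => h; exists l.
by exists l; rewrite !inE.
Qed.

End DualDesign.

(** * Equations between the numbers of a strongly regular graph *)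

Section SrgEquations.
Variables (G : sgraph) (v k lambda mu : nat).
Hypothesis srg : strongly_regular G v k lambda mu.

(** Summing the eigenvalue equation of an eigenvector u for -m over all vertices shows
    that u has sum 0, so that A^2 = k I + lambda A + mu (J - I - A) acts on u without J. *)
Lemma eigenvalue_param (m : nat) : 0 < m ->
  eigenvalue (adjmx G) (- m%:R)%R -> k + m * mu = mu + m * (lambda + m).
Proof.
case: srg => _ deg _ ca cn m0 /eigenvalueP [u hu u0].
pose U (x : G) : algC := u ord0 (enum_rank x).
pose a (x y : G) : algC := ((adj x y)%:R)%R.
(* All sums below run over vertices instead of matrix indices. *)
have hU y : (\sum_z U z * a z y = - m%:R * U y)%R.
  have := congr1 (fun w : 'rV_#|G| => w ord0 (enum_rank y)) hu.
  rewrite !mxE => <-.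
  rewrite (reindex enum_rank) /=; last by apply: onW_bij; exact: enum_rank_bij.
  by apply: eq_bigr => z _; rewrite /U /a mxE !enum_rankK.
have suma z : (\sum_y a z y = k%:R)%R.
  rewrite -(deg z) -sum1_card natr_sum [RHS]big_mkcond /=; apply: eq_bigr => y _.
  by rewrite inE /a; case: (adj z y).
have sumU : (\sum_z U z = 0)%R.
  have : (\sum_y \sum_z U z * a z y = - m%:R * \sum_y U y)%R.
    by rewrite mulr_sumr; apply: eq_bigr => y _.
  rewrite exchange_big /=; under eq_bigr => z _ do rewrite -mulr_sumr suma.
  rewrite -mulr_suml => h.
  have /eqP : ((k + m)%:R * \sum_z U z = 0)%R.
    by rewrite natrD mulrDl mulrC h; ring.
  by rewrite mulf_eq0 pnatr_eq0 addn_eq0 (gtn_eqF m0) andbF => /eqP.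
have [y Uy] : exists y, U y != 0%R.
  have /matrix0Pn [i [j h]] := u0; exists (enum_val j).
  have -> : U (enum_val j) = u i j by rewrite /U enum_valK [i]ord1.
  exact: h.
have sumaa z w : (\sum_x a z x * a x w = #|common_neighbours z w|%:R)%R.
  rewrite -sum1_card natr_sum [RHS]big_mkcond /=; apply: eq_bigr => x _.
  rewrite inE /a (adj_sym x w).
  by case: (adj z x); case: (adj w x); rewrite ?mulr0 ?mul0r ?mul1r.
have e : (\sum_x (\sum_z U z * a z x) * a x y = m%:R ^+ 2 * U y)%R.
  under eq_bigr => x _ do rewrite hU -mulrA.
  by rewrite -mulr_sumr hU; ring.
have e2 : (\sum_x (\sum_z U z * a z x) * a x y =
   (k%:R - mu%:R) * U y + (lambda%:R - mu%:R) * \sum_z U z * a z y + mu%:R * \sum_z U z)%R.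
  under eq_bigr => x _ do rewrite mulr_suml.
  rewrite exchange_big /=.
  transitivity (\sum_z ((k%:R - mu%:R) * ((z == y)%:R * U z)
      + (lambda%:R - mu%:R) * (U z * a z y) + mu%:R * U z))%R.
    apply: eq_bigr => z _; under eq_bigr => x _ do rewrite -mulrA.
    rewrite -mulr_sumr sumaa /a.
    have [->|ne] := eqVneq z y.
      rewrite adj_irrefl (_ : common_neighbours y y = [set w | adj y w]).
        by rewrite deg /=; ring.
      by apply/setP => w; rewrite !inE andbb.
    have [h|h] := boolP (adj z y); first by rewrite ca //=; ring.
    by rewrite cn //=; ring.
  rewrite !big_split /= -!mulr_sumr; congr (_ * _ + _ + _)%R.
  rewrite (bigD1 y) //= eqxx mul1r big1 ?addr0 // => z /negbTE ->.
  by rewrite mul0r.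
have : (((k + m * mu)%:R - (mu + m * (lambda + m))%:R) * U y = 0)%R.
  move: e2; rewrite e hU sumU !(natrD, natrM) => h.
  transitivity ((k%:R - mu%:R) * U y + (lambda%:R - mu%:R) * (- m%:R * U y) + mu%:R * 0
      - m%:R ^+ 2 * U y)%R; first by ring.
  by rewrite h; ring.
move/eqP; rewrite mulf_eq0 (negbTE Uy) orbF subr_eq0 eqr_nat => /eqP //.
Qed.

(** Two vertices at distance 2 and a common neighbour. *)
Lemma srg_nonadjacent : exists x y z : G,
  [/\ x != y, ~~ adj x y, adj x z & adj z y].
Proof.
case: srg => _ deg [d1 [x [y d2]]] ca cn.
have ne : x != y.
  by apply/eqP => e; have := d2 [::] isT e.
have na : ~~ adj x y.
  by apply/negP => h; have := d2 [:: y]; rewrite /= h => /(_ isT erefl).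
have [p [hp lp sp]] := d1 x y.
case: p hp lp sp => [|z [|w [|? ?]]] //=.
- by move=> _ e; move: ne; rewrite e eqxx.
- by rewrite andbT => h e; move: na; rewrite -e h.
- by rewrite andbT => /andP [h1 h2] e _; rewrite e in h2; exists x, y, z.
Qed.

Lemma srg_mu_gt0 : 0 < mu.
Proof.
have [x [y [z [ne na xz zy]]]] := srg_nonadjacent.
case: srg => _ _ _ _ /(_ _ _ ne na) <-; rewrite card_gt0.
by apply/set0Pn; exists z; rewrite inE xz adj_sym.
Qed.

Lemma srg_mu_le_k : mu <= k.
Proof.
have [x [y [z [ne na xz zy]]]] := srg_nonadjacent.
case: srg => _ deg _ _ /(_ _ _ ne na) <-; rewrite -(deg x).
by apply: subset_leq_card; apply/subsetP => w; rewrite !inE => /andP [].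
Qed.

Lemma srg_lambda_lt_k : lambda.+1 < k.
Proof.
have [x [y [z [ne na xz zy]]]] := srg_nonadjacent.
case: srg => _ deg _ /(_ _ _ xz) <- _; rewrite -(deg z).
have <- : #|y |: (x |: common_neighbours x z)| = #|common_neighbours x z|.+2.
  by rewrite !cardsU1 !inE adj_irrefl (negbTE na) eq_sym (negbTE ne).
apply: subset_leq_card; apply/subsetP => w; rewrite !inE.
by case/or3P => [/eqP ->|/eqP ->|/andP []] //; rewrite adj_sym.
Qed.

End SrgEquations.

(** * From line systems to partial geometries *)

(** If every edge is on exactly one line, lines are cliques, and all counts are constant, the
    lines turn the vertices into a partial geometry with the given collinearity graph. *)
Section Assembly.
Variables (G : sgraph) (L : finType) (incL : G -> L -> bool) (s m mu : nat).
Hypothesis joint : forall x y : G, x != y ->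
  #|[set l | incL x l & incL y l]| = adj x y.
Hypothesis s_gt0 : 0 < s.
Hypothesis m_gt1 : 1 < m.
Hypothesis line_deg : forall x, #|[set l | incL x l]| = m.
Hypothesis line_size : forall l, #|[set x | incL x l]| = s + 1.
Variable alpha : nat.
Hypothesis alpha_gt0 : 0 < alpha.
Hypothesis nbrs : forall z l, ~~ incL z l -> #|[set y | incL y l & adj z y]| = alpha.
Hypotheses (G_gt0 : 0 < #|G|) (L_gt0 : 0 < #|L|).

Let S := @IncidenceStructure G L incL G_gt0 L_gt0.

Lemma assembly_pls : partial_linear_space S.
Proof.
move=> x y l l' ne xl yl xl' yl'.
have : #|[set l | incL x l & incL y l]| <= 1 by rewrite joint //; case: (adj x y).
by move/card_le1_eqP => h; apply: h; rewrite inE; apply/andP; split.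
Qed.

Lemma card_meeting_lines z (l : line S) : ~~ inc (z : point S) l ->
  #|[set l' : line S | inc (z : point S) l' & meets l' l]| = alpha.
Proof.
move=> nz; rewrite -(nbrs nz).
rewrite -!sum1_card.
transitivity (\sum_(l' | incL z l') \sum_(y | incL y l' && incL y l) 1).
  transitivity (\sum_(l' | incL z l' && @meets S l' l) 1).
    by apply: eq_bigl => l'; rewrite inE.
  rewrite big_mkcondr; apply: eq_bigr => l' hl'; rewrite sum1_card.
  have [/existsP [y /andP [h h']]|h] := boolP (@meets S l' l); last first.
    rewrite eq_card0 // => y; apply/negP => hy; move/existsP: h; case.
    by exists y.
  rewrite -(card1 y); apply: eq_card => w; rewrite !inE.
  apply/eqP/idP => [->|/andP [k k']]; first by rewrite unfold_in; apply/andP.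
  apply/eqP/negPn/negP => ne; move/negP: nz; apply.
  by rewrite -(assembly_pls ne k h k' h').
rewrite (exchange_big_dep (fun y => incL y l)) /=; last by move=> ? ? _ /andP [].
transitivity (\sum_(y | incL y l && adj z y) 1); last first.
  by apply: eq_bigl => y; rewrite inE.
rewrite big_mkcondr; apply: eq_bigr => y hy.
have ne : z != y by apply/eqP => e; rewrite /= e hy in nz.
rewrite sum1_card; have := joint ne.
rewrite (_ : (if _ then _ else _) = nat_of_bool (adj z y)); last by case: (adj z y).
by move=> <-; apply: eq_card => l'; rewrite !inE unfold_in /= hy andbT.
Qed.

Lemma assembly_pg : is_pg_graph G s (m - 1) alpha.
Proof.
exists S.
  split.
  - by rewrite subn_gt0.
  - exact: assembly_pls.
  - exact: line_size.
  - by move=> x; rewrite subnK ?line_deg // ltnW.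
  - by move=> l x; exact: card_meeting_lines.
exists id; split; first by exists id.
move=> x y; rewrite /= /collinear /=.
have [->|ne] := eqVneq x y; first by rewrite adj_irrefl.
have := joint ne; case: (adj x y) => /= h.
  have : 0 < #|[set l | incL x l & incL y l]| by rewrite h.
  by rewrite card_gt0 => /set0Pn [l]; rewrite inE => hl; apply/existsP; exists l.
apply/existsP => -[l hl]; move/eqP: h; rewrite cards_eq0 => /eqP/setP/(_ l).
by rewrite !inE hl.
Qed.

End Assembly.

(** * Numerical consequences of the lower bound on lambda *)

Section Arithmetic.
(** With m = p + 1, L = lambda + 1 and M = mu - 1, the hypothesis [L_large] is the lower bound
    on lambda, and [kE] is the equation for k. The number q is p / 3 rounded up, and
    claws have at most p + q leaves. *)
Variables (p q M L k : nat).
Hypothesis p_gt0 : 0 < p.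
Hypothesis q_ge : p <= 3 * q.
Hypothesis q_le : 3 * q <= p + 2.
Hypothesis L_large : (8 * p + 6) * M + 9 * p < 3 * L.
Hypothesis kE : k + p * M = (p + 1) * L + p ^ 2.

(** A claw with p + q + 1 leaves would violate [claw_bound]. *)
Lemma claw_arith : k + 'C((p + q).+1, 2) * M < (p + q).+1 * L.
Proof.
have e : 2 * 'C((p + q).+1, 2) = (p + q).+1 * (p + q) by rewrite -mul_bin_diag bin1.
have h1 : 3 * ((p + q).+1 * (p + q)) <= 2 * q * (8 * p + 6) + 6 * p by nia.
have h2 : 6 * 'C((p + q).+1, 2) * M <= (2 * q * (8 * p + 6) + 6 * p) * M.
  by rewrite leq_mul2r; apply/orP; right; lia.
have h3 : 2 * q * ((8 * p + 6) * M + 9 * p + 1) <= 2 * q * (3 * L).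
  by rewrite leq_mul2l; apply/orP; right; lia.
have h4 : 6 * p ^ 2 <= 2 * q * (9 * p) by nia.
have q0 : 0 < q by lia.
rewrite -(ltn_pmul2l (isT : 0 < 6)); nia.
Qed.

(** The hypothesis of [grand_clique_unique]. *)
Lemma unique_arith : 2 * ((p + q - 1) * M) + M < L.
Proof.
have h : 6 * (p + q - 1) + 3 <= 8 * p + 6 by lia.
have : (6 * (p + q - 1) + 3) * M <= (8 * p + 6) * M by rewrite leq_mul2r h orbT.
lia.
Qed.

(** The hypothesis on the size of lines under which the counts are forced. *)
Lemma size_arith (g : nat) : g = L + 1 - (p + q - 1) * M ->
  (k + (p + 1) ^ 2) * (L - M + p) + p * (M + 1) < g * (g - 1) * (L - M + p).
Proof.
move=> ge.
have u := unique_arith.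
pose h := L - (p + q - 1) * M.
have gh : g = h + 1 by rewrite ge /h; lia.
have hE : L = h + (p + q - 1) * M by rewrite /h; lia.
have sM : 3 * ((p + q - 1) * M) <= (4 * p - 1) * M.
  by rewrite mulnA leq_mul2r; apply/orP; right; lia.
have h3 : (4 * p + 7) * M + 9 * p + 1 <= 3 * h by nia.
have h6 : 3 * L + 8 * M + 9 * p + 1 <= 6 * h by nia.
(* The factor L - M + p on the right-hand side is at least M + 1. *)
suff main : k + (p + 1) ^ 2 + p < g * (g - 1).
  have th : M + 1 <= L - M + p by lia.
  have th0 : 0 < L - M + p by lia.
  have h7 : (k + (p + 1) ^ 2 + p) * (L - M + p) < g * (g - 1) * (L - M + p).
    by rewrite ltn_pmul2r.
  by apply: leq_ltn_trans h7; rewrite [X in _ <= X]mulnDl leq_add2l leq_mul2l th orbT.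
rewrite gh addnK.
have [M0|M0] := posnP M.
  have hL : h = L by rewrite /h M0; lia.
  have L3 : 3 * p + 1 <= L by have := L_large; rewrite M0; lia.
  have := kE; rewrite hL M0.
  nia.
have a1 : 13 * p + 8 <= 3 * h by nia.
have a2 : (3 * L + 8 * M + 9 * p + 1) * (13 * p + 8) <= 6 * h * (3 * h) by exact: leq_mul.
have a3 : 18 * (p + 1) * L <= (13 * p + 8) * (3 * L).
  by rewrite mulnA leq_mul2r; apply/orP; right; lia.
have a4 : (9 * p + 9) * (13 * p + 8) <= (8 * M + 9 * p + 1) * (13 * p + 8).
  by rewrite leq_mul2r; apply/orP; right; lia.
have a5 : k <= (p + 1) * L + p ^ 2 by rewrite -kE leq_addr.
rewrite -(ltn_pmul2l (isT : 0 < 18)); lia.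
Qed.

End Arithmetic.

(** * The classification *)

(** A strongly regular graph with eigenvalue -(p + 1) and large lambda is the collinearity
    graph of a partial geometry. *)
Lemma srg_partial_geometry (G : sgraph) (v k lambda mu p : nat) :
  strongly_regular G v k lambda mu ->
  k + (p + 1) * mu = mu + (p + 1) * (lambda + (p + 1)) ->
  0 < p -> (8 * p + 6) * (mu - 1) + 9 * p < 3 * (lambda + 1) ->
  exists s alpha, [/\ is_pg_graph G s p alpha, (p + 1) * s = k,
    (p + 1) * alpha = mu & alpha <= p + 1].
Proof.
move=> srg param p0 large.
have mu0 := srg_mu_gt0 srg; have muk := srg_mu_le_k srg.
have lk := srg_lambda_lt_k srg.
have [_ deg _ ca cn] := srg.
set M := mu - 1 in large; have muE : mu = M + 1 by rewrite /M subnK.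
pose L := lambda + 1.
pose q := (p + 2) %/ 3.
have q_ge : p <= 3 * q by rewrite /q; lia.
have q_le : 3 * q <= p + 2 by rewrite /q; lia.
have kE : k + p * M = (p + 1) * L + p ^ 2.
  move: param; rewrite muE /L; clear; nia.
pose s := p + q.
have cn' (x y : G) : x != y -> ~~ adj x y -> #|common_neighbours x y| <= M.+1.
  by move=> ne na; rewrite cn // muE addn1.
have claw (x : G) (Y : {set G}) : Y \subset nbhd x -> coclique Y -> #|Y| <= s.
  move=> sY iY; rewrite leqNgt; apply/negP => big.
  have := claw_bound ca cn' (deg x) sY iY big.
  by rewrite leqNgt -[lambda.+1]addn1 (claw_arith p0 q_ge q_le large kE).
have uni : 2 * ((s - 1) * M) + M < lambda.+1.
  by rewrite -[lambda.+1]addn1; exact: (unique_arith p0 q_ge q_le large kE).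
pose gc := grand_clique (G := G) lambda M s.
pose LT : finType := {K : {set G} | gc K}.
pose incL (x : G) (l : LT) := x \in val l.
have joint (x y : G) : x != y -> #|[set l : LT | incL x l & incL y l]| = adj x y.
  move=> ne; have [a|na] := boolP (adj x y).
    have [K gK /andP [xK yK]] := grand_clique_exists ca cn' claw a.
    transitivity #|[set (exist gc K gK : LT)]|; last by rewrite cards1.
    apply: eq_card => l.
    rewrite !inE; apply/andP/eqP => [[xl yl]|-> //].
    by apply: val_inj; exact: (grand_clique_unique ca cn' uni ne (valP l) gK).
  apply/eqP; rewrite cards_eq0; apply/eqP/setP => l; rewrite !inE.
  apply/negP => /andP [xl yl]; move/negP: na; apply.
  have /andP [/maxsetp/cliqueP cl _] := valP l.
  exact: cl.
have lsizeE (l : LT) : #|[set x | incL x l]| = #|val l|.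
  by apply: eq_card => x; rewrite inE.
pose g := L + 1 - (s - 1) * M.
have g_le (l : LT) : g <= #|[set x | incL x l]|.
  have /andP [_ h] := valP l; rewrite lsizeE /g /L; lia.
have m0 : 0 < p + 1 by rewrite addn1.
have k0 : 0 < k by apply: leq_trans lk.
have mule : mu <= lambda + (p + 1) by move: param muk p0; clear; nia.
have glarge : (k + (p + 1) ^ 2) * (lambda + (p + 1) + 1 - mu) + (p + 1 - 1) * mu
   < g * (g - 1) * (lambda + (p + 1) + 1 - mu).
  have -> : lambda + (p + 1) + 1 - mu = L - M + p.
    have := uni; rewrite muE /L; lia.
  rewrite addnK muE.
  exact: (size_arith p0 q_ge q_le large kE erefl).
have D := line_deg_eq deg ca cn param k0 mule m0 joint g_le glarge.
have Sz := line_size_eq deg ca cn param k0 mule m0 joint g_le glarge.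
have Nb := line_nbrs deg ca cn param k0 mule m0 joint g_le glarge.
have [x [y [z [ne na xz zy]]]] := srg_nonadjacent srg.
have [K gK /andP [xK zK]] := grand_clique_exists ca cn' claw xz.
pose l0 : LT := exist gc K gK.
pose s' := #|K| - 1.
have s'E : (p + 1) * s' = k by rewrite -(Sz l0) lsizeE.
have s'0 : 0 < s' by case: (s') s'E k0 => //; rewrite muln0 => <-.
have Sz' (l : LT) : #|[set x | incL x l]| = s' + 1.
  have := Sz l; rewrite -s'E => /eqP; rewrite eqn_pmul2l // => /eqP <-.
  rewrite subnK //; have := Sz l; case: (#|_|) k0 => //; rewrite muln0 => + e.
  by rewrite -e.
pose alpha := mu %/ (p + 1).
have Nb' (w : G) (l : LT) : ~~ incL w l -> #|[set u | incL u l & adj w u]| = alpha.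
  by move=> h; rewrite /alpha -(Nb _ _ h) mulKn.
have yl0 : ~~ incL y l0.
  apply/negP => yK; move/negP: na; apply.
  by have /andP [/maxsetp/cliqueP cl _] := gK; exact: cl.
have aE : (p + 1) * alpha = mu by rewrite -(Nb' _ _ yl0); exact: Nb.
have a0 : 0 < alpha by case: (alpha) aE mu0 => //; rewrite muln0 => <-.
have G0 : 0 < #|G| by apply/card_gt0P; exists x.
have L0 : 0 < #|LT| by apply/card_gt0P; exists l0.
have m1 : 1 < p + 1 by rewrite addn1.
have pg := assembly_pg joint s'0 m1 D Sz' a0 Nb' G0 L0.
exists s', alpha; split => //; first by rewrite addnK in pg.
rewrite -(card_meeting_lines joint Nb' (G_gt0 := G0) (L_gt0 := L0) yl0) -(D y).
by apply: subset_leq_card; apply/subsetP => l; rewrite !inE => /andP [].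
Qed.

Theorem theorem1p3 (G : sgraph) (v k lambda mu m : nat)
  (hsrg : strongly_regular G v k lambda mu)
  (hprim : primitive G)
  (hconf : ~ conference G)
  (hm : 0 < m)
  (heig : smallest_eigenvalue G (- m%:R)%R) :
  [/\ (* (i) *)
      mu = m * (m - 1) -> (fbound m mu < lambda%:R)%R ->
        (exists s t alpha : nat, alpha = t /\ is_pg_graph G s t alpha) /\
        (exists n : nat,
           (n%:Z = lambda%:Z - m%:Z * (m%:Z - 3))%R /\
           is_latin_square_graph G m n),
      (* (ii) *)
      mu = m ^ 2 -> (fbound m mu < lambda%:R)%R ->
        (exists s t alpha : nat, alpha = t + 1 /\ is_pg_graph G s t alpha) /\
        (exists V : nat,
           (V%:Z = lambda%:Z * (m%:Z - 1) - m%:Z * (m%:Z - 1) * (m%:Z - 2)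
                   + m%:Z)%R /\
           is_design_block_graph G 2 V m 1)
    & (* (iii) *)
      mu <> m * (m - 1) -> mu <> m ^ 2 -> (lambda%:R <= fbound m mu)%R].
Proof.
have param := eigenvalue_param hsrg hm heig.1.
have mu0 := srg_mu_gt0 hsrg; have lk := srg_lambda_lt_k hsrg.
have m1 : 1 < m.
  by rewrite ltn_neqAle hm andbT; apply/eqP => e; move: param lk; rewrite -e; lia.
have [p mE p0] : exists2 p, m = p + 1 & 0 < p.
  by exists (m - 1); rewrite ?subn_gt0 ?subnK.
have geo : (fbound m mu < lambda%:R)%R -> exists s alpha,
    [/\ is_pg_graph G s p alpha, lambda + p + 1 = s + p * alpha,
        (p + 1) * alpha = mu, alpha <= p + 1 & ~ alpha < p].
  move=> hf.
  have large : (8 * p + 6) * (mu - 1) + 9 * p < 3 * (lambda + 1).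
    have : (8%:R * m%:R * (mu%:R - 1) - 2%:R * mu%:R + 9%:R * m%:R - 10%:R
        < 3%:R * lambda%:R :> rat)%R by move: hf; rewrite /fbound; lra.
    rewrite mE -{1 2}(subnK mu0) !natrD -(ltr_nat rat) !(natrM, natrD) => h.
    nra.
  rewrite mE in param.
  have [s [alpha [pg sE aE ale]]] := srg_partial_geometry hsrg param p0 large.
  have lE : lambda + p + 1 = s + p * alpha.
    have : (p + 1) * (s + p * alpha) = (p + 1) * (lambda + p + 1).
      move: param; rewrite -sE -aE; clear; nia.
    by move/eqP; rewrite eqn_pmul2l ?addn1 // => /eqP.
  exists s, alpha; split => // ap.
  have [S pgS _] := pg.
  have a0 : 0 < alpha by case: pgS => -[].
  have := pg_bound pgS ap; rewrite ltnNge => /negP; apply.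
  have M : mu - 1 = (p + 1) * alpha - 1 by rewrite aE.
  rewrite M in large.
  have l3 : 3 * (lambda + 1) + 3 * p = 3 * s + 3 * p * alpha by lia.
  have e : (8 * p + 6) * ((p + 1) * alpha - 1) + (8 * p + 6) =
       8 * p ^ 2 * alpha + 14 * p * alpha + 6 * alpha.
    by rewrite -mulnSr subn1 prednK ?muln_gt0 ?addn1 //; nia.
  have pa : p <= p * alpha by rewrite leq_pmulr.
  lia.
split.
- move=> muE hf; have [s [alpha [pg lE aE _ _]]] := geo hf.
  have al : alpha = p.
    move: aE; rewrite muE mE addnK => /eqP; rewrite eqn_pmul2l ?addn1 // => /eqP //.
  rewrite al in pg lE; split; first by exists s, p, p.
  exists s.+1; split; first by rewrite mE; lia.
  have [S pgS iso] := pg.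
  have [A oA isoA] := net_latin_square_graph pgS.
  rewrite mE addn1; exists A => //; exact: isomorphic_trans iso isoA.
- move=> muE hf; have [s [alpha [pg lE aE _ _]]] := geo hf.
  have al : alpha = p + 1.
    move: aE; rewrite muE mE expnS expn1 => /eqP; rewrite eqn_pmul2l ?addn1 // => /eqP //.
  rewrite al in pg lE; split; first by exists s, p, (p + 1).
  exists ((s + 1) * p + 1); split; first by rewrite mE; nia.
  have [S pgS iso] := pg.
  have [P [B [dB isoB]]] := dual_design_block_graph pgS.
  have -> : m = p.+1 by rewrite mE addn1.
  exists P, B; split=> //.
  exact: isomorphic_trans iso isoB.
- move=> n1 n2; rewrite leNgt; apply/negP => hf.
  have [s [alpha [pg lE aE ale nlt]]] := geo hf.
  have : alpha = p \/ alpha = p + 1 by lia.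
  case=> al; rewrite al in aE.
    by apply: n1; rewrite -aE mE addnK.
  by apply: n2; rewrite -aE mE expnS expn1.
Qed.
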